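(* Fix $\theta>0$. If $C^{(n)}$ is distributed as the cycle counts of an ESF$(\theta)$ random permutation of $[n]$, then \[\sup_{x\in\mathbb{R}}\left|\mathbb{P}\!\left(\frac{\log\mathsf{invol}_n(C^{(n)})-\frac{\theta}{2}\log^2 n}{\sqrt{\frac{\theta}{3}\log^3 n}}\le x\right)-\Phi(x)\right|=O\!\left(\frac{1}{\sqrt{\log n}}\right),\] where $\Phi$ is the standard normal distribution function.
   Context: ESF$(\theta)$ is the Ewens measure on $\mathfrak{S}_n$: $\mathbb{P}(\sigma=\sigma_0)=\theta^{K(\sigma_0)}/\theta^{(n)}$, with $K$ the number of cycles and $\theta^{(n)}=\theta(\theta+1)\cdots(\theta+n-1)$; cycle counts $c_k$ = number of cycles of length $k$. For nonnegative integer vector $a$: $\mathsf{invol}_n(a)=\prod_{k=1}^n k^{a_k}\sum_{j=0}^{\lfloor a_k/2\rfloor}\frac{(a_k)_{2j}}{(2k)^j j!}$ with $(x)_r=x(x-1)\cdots(x-r+1)$; for cycle counts of $\sigma$ this equals the number of ordered pairs of involutions $(\tau_1,\tau_2)$ in $\mathfrak{S}_n$ with $\sigma=\tau_2\circ\tau_1$. *)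

(* Defs.v *)
From Stdlib Require Import Reals.
From Coquelicot Require Import Coquelicot.
From mathcomp Require Import all_boot all_order all_algebra all_fingroup.
From mathcomp Require Import Rstruct.

Set Implicit Arguments.
Unset Strict Implicit.
Unset Printing Implicit Defensive.

Import GRing.Theory Num.Theory.

Local Open Scope ring_scope.

(* number of cycles of s (fixed points count as cycles of length 1) *)
Definition ncycles (n : nat) (s : 'S_n) : nat := #|porbits s|.

Definition cycle_counts (n : nat) (s : 'S_n) (k : nat) : nat :=
  #|[set C in porbits s | #|C| == k]|.

Definition rising (theta : R) (n : nat) : R := \prod_(i < n) (theta + i%:R).

Definition esf_prob (theta : R) (n : nat) (E : pred 'S_n) : R :=
  \sum_(s : 'S_n | E s) theta ^+ ncycles s / rising theta n.

Arguments esf_prob : clear implicits.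

Definition invol (n : nat) (a : nat -> nat) : R :=
  \prod_(1 <= k < n.+1)
     ((k%:R) ^+ (a k) *
      \sum_(0 <= j < (a k)./2.+1)
         (((a k) ^_ (2 * j))%:R / (((2 * k)%:R) ^+ j * (j`!)%:R))).

Local Close Scope ring_scope.
Local Open Scope R_scope.

Definition Phi (x : R) : R :=
  / 2 + / sqrt (2 * PI) * RInt (fun t => exp (- (t ^ 2) / 2)) 0 x.

Definition norm_log_invol (theta : R) (n : nat) (s : 'S_n) : R :=
  (ln (invol n (cycle_counts s)) - theta / 2 * (ln (INR n)) ^ 2)
     / sqrt (theta / 3 * (ln (INR n)) ^ 3).

(* Main.v *)
(* The logarithm of [invol] is the logarithm of the product of the cycle lengths up to a
   nonnegative correction which is O(log n) outside an event of probability O(1 / log n). In the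
   Feller coupling the cycle lengths are the spacings between the ones of independent Bernoulli
   variables xi_q of parameter theta / (theta + q - 1), so that
     sum log (cycle lengths) = log (n + 1) + sum_q xi_q log q - sum_j log (p_(j+1) / (p_(j+1) - p_j)),
   where p_1 < p_2 < ... are the positions of the ones. The last sum is O(log n) outside an
   event of probability O(1 / n), by an exponential moment bound obtained from a supersolution of
   the backward recursion. Since the standard deviation is of order (log n)^(3/2), errors of size
   O(log n) cost only O(1 / sqrt (log n)), and it remains to treat sum_q xi_q log q. Its
   Berry-Esseen bound comes from Stein's method: for summands bounded by d, the zero-bias identity
   expresses E (Y f(Y)) by difference quotients of f at scale d, so that comparing with the Stein
   equation needs no concentration inequality. *)

Require Import Defs.
From Stdlib Require Import Reals Lra.
From Coquelicot Require Import Coquelicot.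
From mathcomp Require Import all_boot all_order all_algebra all_fingroup.
From mathcomp Require Import Rstruct.

Set Implicit Arguments.
Unset Strict Implicit.
Unset Printing Implicit Defensive.

(** * The normal law and Stein's equation *)

Section Gaussian.

Local Open Scope R_scope.

(** The largest normalised summand has size L / sg = sqrt (3 / th) / sqrt L with L = log n, so a
    bound linear in it already has the required order. For the sum of log ratios a first moment
    would not do: its mean is itself of order log n, so Markov's inequality at level C log n gives
    only a constant. The exponential moment is taken at exponent 1/2, because the mean of a ratio p
    / (p - p') grows like log p while that of its square root stays bounded. The product over all
    spacings still grows with their number, so each spacing is charged a constant factor, repaid on
    the event that there are O(log n) spacings. No bijection identifies cycles with spacings: both
    laws are shown to evolve by the Chinese restaurant process, and only permutation-invariant
    functionals of the list of lengths are compared. *)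

Lemma exp_le_mono x y : x <= y -> exp x <= exp y.
Proof. by case => [lt_xy | ->]; [apply/Rlt_le/exp_increasing | apply: Rle_refl]. Qed.

Definition gauss (t : R) : R := exp (- (t ^ 2) / 2).
Definition gint (x : R) : R := RInt gauss 0 x.

Lemma gauss_pos t : 0 < gauss t.
Proof. exact: exp_pos. Qed.

Lemma is_derive_gauss t : is_derive gauss t (- t * gauss t).
Proof. by rewrite /gauss; auto_derive => //; rewrite /= /Rdiv; field. Qed.

Lemma continuous_gauss t : continuous gauss t.
Proof. by apply: ex_derive_continuous; eexists; apply: is_derive_gauss. Qed.

Lemma ex_RInt_gauss a b : ex_RInt gauss a b.
Proof. by apply: ex_RInt_continuous => z _; apply: continuous_gauss. Qed.

Lemma is_derive_gint x : is_derive gint x (gauss x).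
Proof.
apply: (is_derive_RInt _ _ 0); last exact: continuous_gauss.
by apply: filter_forall => y; apply: RInt_correct; apply: ex_RInt_gauss.
Qed.

Let polar (x t : R) : R := 2 * exp (- (x ^ 2) * (1 + t ^ 2) / 2) / (1 + t ^ 2).

Let one_sq_neq0 (t : R) : 1 + t ^ 2 <> 0.
Proof. nra. Qed.

Let is_derive_polar x t :
  is_derive (fun u => polar u t) x (- 2 * x * exp (- (x ^ 2) * (1 + t ^ 2) / 2)).
Proof.
have H := @one_sq_neq0 t.
by rewrite /polar; auto_derive => //=; rewrite /Rdiv /= in H *; field; nra.
Qed.

Let ex_RInt_polar x a b : ex_RInt (polar x) a b.
Proof.
apply: ex_RInt_continuous => z _; apply: ex_derive_continuous.
by rewrite /polar; auto_derive; have := @one_sq_neq0 z.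
Qed.

(** Differentiation leaves [-2 * gauss x] times the integral of [x * gauss (x * t)] over t in
    [0, 1], which is [gint x] by the substitution u = x t. *)
Let is_derive_polar_int x :
  is_derive (fun x => RInt (polar x) 0 1) x (- 2 * gauss x * gint x).
Proof.
have -> : - 2 * gauss x * gint x
   = RInt (fun t => Derive (fun u => polar u t) x) 0 1.
  rewrite (RInt_ext _ (fun t => scal (- 2 * gauss x) (scal x (gauss (x * t + 0))))).
    rewrite RInt_scal; last first.
      apply: ex_RInt_continuous => z _; apply: ex_derive_continuous.
      by rewrite /gauss /scal /= /mult /=; auto_derive.
    rewrite RInt_comp_lin ?Rmult_0_r ?Rmult_1_r ?Rplus_0_l ?Rplus_0_r //.
    exact: ex_RInt_gauss.
  move=> t _; rewrite (is_derive_unique _ _ _ (is_derive_polar x t)).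
  rewrite /scal /= /mult /= /gauss.
  have -> : - (x ^ 2) * (1 + t ^ 2) / 2 = - x ^ 2 / 2 + - (x * t + 0) ^ 2 / 2 by field.
  by rewrite exp_plus; ring.
apply: (is_derive_RInt_param polar 0 1 x).
- by apply: filter_forall => y t _; eexists; apply: is_derive_polar.
- move=> t _.
  apply: (continuity_2d_pt_ext
    (fun u v => - 2 * u * exp (- (u * u) * (1 + v * v) / 2))).
    move=> u v; rewrite (is_derive_unique _ _ _ (is_derive_polar u v)).
    by rewrite /= !Rmult_1_r.
  apply: continuity_2d_pt_mult.
    apply: continuity_2d_pt_mult; first exact: continuity_2d_pt_const.
    exact: continuity_2d_pt_id1.
  apply: continuity_1d_2d_pt_comp.
    by apply: derivable_continuous_pt; apply: derivable_pt_exp.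
  have c1 := continuity_2d_pt_id1 x t; have c2 := continuity_2d_pt_id2 x t.
  apply: continuity_2d_pt_mult; last exact: continuity_2d_pt_const.
  apply: continuity_2d_pt_mult.
    by apply: continuity_2d_pt_opp; apply: continuity_2d_pt_mult.
  apply: continuity_2d_pt_plus; first exact: continuity_2d_pt_const.
  by apply: continuity_2d_pt_mult.
- by apply: filter_forall => y; apply: ex_RInt_polar.
Qed.

Let polar_int0 : RInt (polar 0) 0 1 = PI / 2.
Proof.
rewrite (RInt_ext _ (fun t => scal 2 (/ (1 + Rsqr t)))); last first.
  move=> t _; rewrite /polar /scal /= /mult /= /Rsqr.
  have -> : - (0 * (0 * 1)) * (1 + t * (t * 1)) / 2 = 0 by field.
  by rewrite exp_0 !Rmult_1_r.
have I : is_RInt (fun t => / (1 + Rsqr t)) 0 1 (minus (atan 1) (atan 0)).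
  apply: is_RInt_derive => t _; first exact: is_derive_atan.
  apply: ex_derive_continuous; rewrite /Rsqr; auto_derive.
  by have := @one_sq_neq0 t; rewrite /= Rmult_1_r.
rewrite RInt_scal; last by eexists; exact: I.
rewrite (is_RInt_unique _ _ _ _ I) atan_1 atan_0.
change (2 * (PI / 4 + - 0) = PI / 2); lra.
Qed.

(* The derivative of [gint ^ 2 + RInt (polar _) 0 1] vanishes: this replaces the passage to polar
   coordinates. *)
Lemma gint_sq_bounds x : PI / 2 - 2 * gauss x <= gint x ^ 2 <= PI / 2.
Proof.
pose H u := gint u ^ 2 + RInt (polar u) 0 1.
have dH u : is_derive H u 0.
  have -> : (0 : R) = INR 2 * gauss u * gint u ^ 1 + (- 2 * gauss u * gint u).
    by rewrite /=; ring.
  apply: (@is_derive_plus _ _ (fun u => gint u ^ 2)); last exact: is_derive_polar_int.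
  by apply: (is_derive_pow gint 2); apply: is_derive_gint.
have eqH : H x = H 0.
  have [u _|u _|c [_]] := MVT_gen H 0 x (fun => 0); first exact: dH.
    apply: (proj2 (continuity_pt_filterlim H u)).
    by apply: ex_derive_continuous; eexists; apply: dH.
  by lra.
have : H 0 = PI / 2.
  by rewrite /H polar_int0 /gint RInt_point /zero /=; ring.
rewrite -eqH /H => eqx.
have lo : 0 <= RInt (polar x) 0 1.
  apply: RInt_ge_0 => //; first by lra.
  move=> t _; rewrite /polar; apply: Rmult_le_pos; last first.
    by apply/Rlt_le/Rinv_0_lt_compat; nra.
  by have := exp_pos (- (x ^ 2) * (1 + t ^ 2) / 2); lra.
have up : RInt (polar x) 0 1 <= RInt (fun => 2 * gauss x) 0 1.
  apply: RInt_le => //; first by lra.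
    exact: ex_RInt_const.
  move=> t _; rewrite /polar.
  have e : exp (- (x ^ 2) * (1 + t ^ 2) / 2) <= gauss x.
    apply: exp_le_mono.
    by have := pow2_ge_0 (x * t); nra.
  have p := exp_pos (- (x ^ 2) * (1 + t ^ 2) / 2).
  apply: (Rmult_le_reg_r (1 + t ^ 2)); first by nra.
  have -> : 2 * exp (- x ^ 2 * (1 + t ^ 2) / 2) / (1 + t ^ 2) * (1 + t ^ 2)
    = 2 * exp (- x ^ 2 * (1 + t ^ 2) / 2) by field; apply: (@one_sq_neq0 t).
  have := pow2_ge_0 t; nra.
rewrite RInt_const /scal /= /mult /= in up; rewrite /= in eqx *; lra.
Qed.

End Gaussian.

(** * Gaussian tail and Mills ratio *)

Section NormalLaw.

Local Open Scope R_scope.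

Let c0 := sqrt (2 * PI).

Let c0_sq : c0 ^ 2 = 2 * PI.
Proof. by rewrite /c0 /= Rmult_1_r sqrt_sqrt //; have := PI_RGT_0; lra. Qed.

Let c0_ge2 : 2 <= c0.
Proof.
have := PI2_3_2 => h; have p : 0 <= c0 by apply: sqrt_pos.
have := c0_sq; rewrite /PI; nra.
Qed.

Lemma gauss_le1 t : gauss t <= 1.
Proof. by rewrite -exp_0; apply: exp_le_mono; nra. Qed.

Lemma gauss_opp t : gauss (- t) = gauss t.
Proof. by rewrite /gauss; congr exp; field. Qed.

Lemma gint_opp x : gint (- x) = - gint x.
Proof.
rewrite /gint -[- x](_ : -1 * x + 0 = - x); last by ring.
rewrite -{1}(_ : -1 * 0 + 0 = 0); last by ring.
rewrite -RInt_comp_lin; last exact: ex_RInt_gauss.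
rewrite RInt_scal; last first.
  apply: ex_RInt_continuous => z _; apply: ex_derive_continuous.
  by rewrite /gauss; auto_derive.
rewrite (RInt_ext _ gauss) => [|t _]; first by rewrite /scal /= /mult /=; ring.
by rewrite -(gauss_opp t); congr gauss; ring.
Qed.

Lemma gint_ge0 x : 0 <= x -> 0 <= gint x.
Proof.
move=> x0; apply: RInt_ge_0 => //; first exact: ex_RInt_gauss.
by move=> t _; apply/Rlt_le/gauss_pos.
Qed.

Definition gtail (w : R) : R := c0 / 2 - gint w.

Lemma PhiE x : c0 * Phi x = c0 / 2 + gint x.
Proof.
rewrite /Phi -/c0 -[RInt _ 0 x]/(gint x); field.
by have := c0_ge2; lra.
Qed.

Lemma gtailE w : gtail w = c0 * (1 - Phi w).
Proof. by rewrite Rmult_minus_distr_l PhiE /gtail; field. Qed.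

Lemma gtail_ge0 w : 0 <= gtail w.
Proof.
have [_] := gint_sq_bounds w; have := c0_sq; have := c0_ge2.
rewrite /gtail /=; nra.
Qed.

Lemma Phi_opp x : Phi (- x) = 1 - Phi x.
Proof.
have := c0_ge2; have := PhiE x; have := PhiE (- x); rewrite gint_opp.
move=> e1 e2 h; apply: (Rmult_eq_reg_l c0); lra.
Qed.

Lemma Phi_le1 x : Phi x <= 1.
Proof.
have := gtail_ge0 x; rewrite gtailE => h; have := c0_ge2; nra.
Qed.

Lemma Phi_ge0 x : 0 <= Phi x.
Proof. by have := Phi_le1 (- x); rewrite Phi_opp; lra. Qed.

(** Difference of squares: [gtail w * (c0 / 2 + gint w)] equals PI / 2 - [gint w ^ 2], which
    [gint_sq_bounds] controls, and the second factor is at least 1. *)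
Lemma gtail_le w : 0 <= w -> gtail w <= 2 * gauss w.
Proof.
move=> w0; have [lo _] := gint_sq_bounds w; have := c0_sq; have := c0_ge2.
have g0 := gint_ge0 w0; have t0 := gtail_ge0 w; move: lo t0.
rewrite /gtail /= => lo t0 h1 h2.
have : (c0 / 2 - gint w) * (c0 / 2 + gint w) <= 2 * gauss w by nra.
have := gauss_pos w; nra.
Qed.

Lemma is_derive_gtail w : is_derive gtail w (- gauss w).
Proof.
rewrite /gtail -[- gauss w]Rplus_0_l; apply: (@is_derive_minus _ _ (fun => c0 / 2)).
  exact: is_derive_const.
exact: is_derive_gint.
Qed.

Lemma mvt_derive (f df : R -> R) a b :
  a <= b -> (forall t, is_derive f t (df t)) ->
  exists c, a <= c <= b /\ f b - f a = df c * (b - a).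
Proof.
move=> ab d; have [t _|c []] := MVT_gen f a b df (fun t _ => d t).
  apply: (proj2 (continuity_pt_filterlim f t)).
  by apply: ex_derive_continuous; eexists; apply: d.
by rewrite Rmin_left // Rmax_right //; exists c.
Qed.

(** For positive w, the gap [E] between the two sides has derivative [- gtail], so it decreases, and
    it is at least -4 / T at T; letting T grow shows that it is nonnegative. *)
Lemma mills_ineq w : w * gtail w <= gauss w.
Proof.
have [w0|w0] := Rle_lt_dec w 0.
  by have := gtail_ge0 w; have := gauss_pos w; nra.
pose E t := gauss t - t * gtail t.
have dE t : is_derive E t (- gtail t).
  have -> : - gtail t = - t * gauss t - (1 * gtail t + t * (- gauss t)) by ring.
  apply: (@is_derive_minus _ _ gauss (fun t => t * gtail t)).
    exact: is_derive_gauss.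
  apply: (is_derive_mult (fun t => t) gtail); first exact: is_derive_id.
    exact: is_derive_gtail.
  exact: Rmult_comm.
have decr T : w <= T -> - (4 / T) <= E w.
  move=> wT; have [c [_]] := mvt_derive wT dE.
  have := gtail_ge0 c => tc e.
  have : E T <= E w by nra.
  have := gtail_le (ltac:(lra) : 0 <= T).
  have : gauss T * T ^ 2 <= 2.
    have := exp_ineq1_le (T ^ 2 / 2).
    have -> : gauss T = / exp (T ^ 2 / 2).
      by rewrite -exp_Ropp /gauss; congr exp; field.
    move=> h; apply: (Rmult_le_reg_l (exp (T ^ 2 / 2))); first exact: exp_pos.
    rewrite -Rmult_assoc Rinv_r; last by have := exp_pos (T ^ 2 / 2); lra.
    by nra.
  rewrite /E => h1 h2 h3; have := gauss_pos T => gp.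
  apply: (Rle_trans _ (- (T * (2 * gauss T)))); last by nra.
  apply: Ropp_le_contravar; apply: (Rmult_le_reg_r T); first by lra.
  have -> : 4 / T * T = 4 by field; lra.
  nra.
have [|neg] := Rle_lt_dec 0 (E w); first by rewrite /E; lra.
(* This T makes 4 / T at most half of [- E w], against the bound [decr]. *)
have T1 := decr (Rmax w (8 / - E w)) (Rmax_l _ _).
have T2 := Rmax_r w (8 / - E w); set T := Rmax _ _ in T1 T2.
have p : 0 < 8 / - E w by apply: Rdiv_lt_0_compat; lra.
have : 4 / T <= - E w / 2.
  apply: (Rmult_le_reg_r T); first by lra.
  have -> : 4 / T * T = 4 by field; lra.
  have -> : 4 = - E w / 2 * (8 / - E w) by field; lra.
  by apply: Rmult_le_compat_l; lra.
lra.
Qed.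

Definition mills (w : R) : R := gtail w / gauss w.

Lemma mills_ge0 w : 0 <= mills w.
Proof.
apply: Rmult_le_pos; first exact: gtail_ge0.
by apply/Rlt_le/Rinv_0_lt_compat/gauss_pos.
Qed.

Lemma mills_le2 w : 0 <= w -> mills w <= 2.
Proof.
move=> w0; have g := gauss_pos w; apply: (Rmult_le_reg_r (gauss w)) => //.
rewrite /mills /Rdiv Rmult_assoc Rinv_l; last by lra.
by have := gtail_le w0; lra.
Qed.

Lemma mul_mills_le1 w : w * mills w <= 1.
Proof.
have g := gauss_pos w; apply: (Rmult_le_reg_r (gauss w)) => //.
rewrite /mills /Rdiv !Rmult_assoc Rinv_l; last by lra.
by have := mills_ineq w; lra.
Qed.

Lemma is_derive_mills w : is_derive mills w (w * mills w - 1).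
Proof.
have g := gauss_pos w; rewrite /mills.
have -> : w * (gtail w / gauss w) - 1 =
  (- gauss w * gauss w - gtail w * (- w * gauss w)) / gauss w ^ 2.
  by field; lra.
apply: (is_derive_div gtail gauss); last lra.
  exact: is_derive_gtail.
exact: is_derive_gauss.
Qed.

(** The two branches of [stein] meet at w = x because of this identity. *)
Lemma mills_refl w : Phi w * mills w = (1 - Phi w) * mills (- w).
Proof.
rewrite /mills !gtailE gauss_opp Phi_opp; field.
by have := gauss_pos w; lra.
Qed.

Lemma Phi_incr x y : x <= y -> Phi x <= Phi y.
Proof.
move=> xy; have [c [_ e]] := mvt_derive xy is_derive_gint.
have := PhiE x; have := PhiE y; have := gauss_pos c; have := c0_ge2.
move=> h1 h2 h3 h4; apply: (Rmult_le_reg_l c0); nra.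
Qed.

Lemma Phi_lipschitz x y : x <= y -> Phi y - Phi x <= y - x.
Proof.
move=> xy; have [c [_ e]] := mvt_derive xy is_derive_gint.
have := PhiE x; have := PhiE y; have := gauss_pos c; have := gauss_le1 c; have := c0_ge2.
move=> h1 h5 h2 h3 h4; apply: (Rmult_le_reg_l c0); nra.
Qed.

End NormalLaw.

(** * The solution of Stein's equation *)

Section Stein.

Local Open Scope R_scope.

Definition indle (a b : R) : R := if Rle_dec a b then 1 else 0.

Lemma indle_true a b : a <= b -> indle a b = 1.
Proof. by rewrite /indle; case: Rle_dec. Qed.

Lemma indle_false a b : b < a -> indle a b = 0.
Proof. by rewrite /indle; case: Rle_dec => [ab ba|//]; lra. Qed.

Lemma indle_bounds a b : 0 <= indle a b <= 1.
Proof. by rewrite /indle; case: Rle_dec => ? /=; split; lra. Qed.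

Lemma indle_mono a b c d : (a <= b -> c <= d) -> indle a b <= indle c d.
Proof.
rewrite /indle => h; case: (Rle_dec a b) => [ab|?]; case: (Rle_dec c d) => [cd|ncd] /=; try lra.
Qed.

(* The bounded solution of Stein's equation [f' w = w f w + 1_{w <= x} - Phi x]. *)
Definition stein (x w : R) : R :=
  if Rle_dec w x then (1 - Phi x) * mills (- w) else Phi x * mills w.

Lemma stein_left x w : w <= x -> stein x w = (1 - Phi x) * mills (- w).
Proof. by rewrite /stein; case: Rle_dec. Qed.

Lemma stein_right x w : x <= w -> stein x w = Phi x * mills w.
Proof.
case=> [xw|<-]; last by rewrite stein_left ?mills_refl //; apply: Rle_refl.
by rewrite /stein; case: Rle_dec => //=; lra.
Qed.

Lemma stein_sym x w : stein x w = stein (- x) (- w).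
Proof.
have [wx|xw] := Rle_lt_dec w x.
  rewrite stein_left // (@stein_right (- x)); last by lra.
  by rewrite Phi_opp.
rewrite stein_right; last by lra.
rewrite (@stein_left (- x)); last by lra.
by rewrite Phi_opp Ropp_involutive; ring.
Qed.

(** For x <= w < 0 the factor [mills w] has no uniform bound; monotonicity of [Phi] and [mills_refl]
    trade [Phi x * mills w] for [mills (- w)], which is at most 2. *)
Let stein_bounds_right x w : x <= w ->
  0 <= stein x w <= 2 /\ -1 <= w * stein x w <= 1.
Proof.
move=> xw; rewrite stein_right //.
have p0 := Phi_ge0 x; have p1 := Phi_le1 x; have m0 := mills_ge0 w.
have m1 := mul_mills_le1 w.
have [w0|w0] := Rle_lt_dec 0 w.
  by have := mills_le2 w0; split; nra.
have refl := mills_refl w; have Pw := Phi_incr xw.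
have q0 := Phi_ge0 w; have q1 := Phi_le1 w.
have n0 := mills_ge0 (- w); have n1 := mul_mills_le1 (- w).
have n2 : mills (- w) <= 2 by apply: mills_le2; lra.
have h : Phi x * mills w <= mills (- w).
  by apply: (Rle_trans _ (Phi w * mills w)); nra.
have : 0 <= Phi x * mills w by nra.
by split; nra.
Qed.

Let stein_bounds x w : 0 <= stein x w <= 2 /\ -1 <= w * stein x w <= 1.
Proof.
have [xw|wx] := Rle_lt_dec x w; first exact: stein_bounds_right.
have := @stein_bounds_right (- x) (- w); rewrite -stein_sym => h.
by have := h ltac:(lra); lra.
Qed.

Lemma stein_ge0_le2 x w : 0 <= stein x w <= 2.
Proof. by have [] := stein_bounds x w. Qed.

Lemma mul_stein_bounds x w : -1 <= w * stein x w <= 1.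
Proof. by have [] := stein_bounds x w. Qed.

Let left_branch x w := (1 - Phi x) * mills (- w).
Let right_branch x w := Phi x * mills w.

Let is_derive_left x w :
  is_derive (left_branch x) w (w * left_branch x w + (1 - Phi x)).
Proof.
have -> : w * left_branch x w + (1 - Phi x) =
    (1 - Phi x) * (-1 * (- w * mills (- w) - 1)) by rewrite /left_branch; ring.
apply: is_derive_scal; apply: (is_derive_comp mills Ropp).
  exact: is_derive_mills.
apply: (@is_derive_opp _ _ (fun t => t)); exact: is_derive_id.
Qed.

Let is_derive_right x w :
  is_derive (right_branch x) w (w * right_branch x w - Phi x).
Proof.
have -> : w * right_branch x w - Phi x =
    Phi x * (w * mills w - 1) by rewrite /right_branch; ring.
by apply: is_derive_scal; apply: is_derive_mills.
Qed.

Let is_derive_mul_id (f : R -> R) w l :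
  is_derive f w l -> is_derive (fun t => t * f t) w (f w + w * l).
Proof.
move=> d; rewrite -[f w]Rmult_1_l.
apply: (is_derive_mult (fun t => t) f) => //; first exact: is_derive_id.
exact: Rmult_comm.
Qed.

(** Integrated form of Stein's equation, avoiding the corner at x: the mean value theorem is applied
    on each smooth branch. The indicator decreases, so its value at the left end bounds it from
    above; [stein_incr_ge] uses the right end. *)
Lemma stein_incr_le x a b M : a <= b ->
  (forall w, a <= w <= b -> w * stein x w <= M) ->
  stein x b - stein x a <= (b - a) * (M + indle a x - Phi x).
Proof.
have lft u v : u <= v -> v <= x -> (forall w, u <= w <= v -> w * stein x w <= M) ->
    stein x v - stein x u <= (v - u) * (M + 1 - Phi x).
  move=> uv vx h; have [c [cuv]] := mvt_derive uv (is_derive_left x).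
  have := h c cuv; rewrite !stein_left; try lra.
  by rewrite /left_branch => hc ->; nra.
have rgt u v : u <= v -> x <= u -> (forall w, u <= w <= v -> w * stein x w <= M) ->
    stein x v - stein x u <= (v - u) * (M - Phi x).
  move=> uv vx h; have [c [cuv]] := mvt_derive uv (is_derive_right x).
  have := h c cuv; rewrite !stein_right; try lra.
  by rewrite /right_branch => hc ->; nra.
move=> ab h; have [bx|xb] := Rle_lt_dec b x.
  rewrite indle_true; last lra.
  exact: lft.
have [ax|xa] := Rle_lt_dec a x; last first.
  by rewrite indle_false //; have := rgt a b ab ltac:(lra) h; lra.
rewrite indle_true //.
have l := lft a x ax (Rle_refl x) (fun w hw => h w ltac:(lra)).
have r := rgt x b ltac:(lra) (Rle_refl x) (fun w hw => h w ltac:(lra)).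
nra.
Qed.

Lemma stein_incr_ge x a b m : a <= b ->
  (forall w, a <= w <= b -> m <= w * stein x w) ->
  (b - a) * (m + indle b x - Phi x) <= stein x b - stein x a.
Proof.
have lft u v : u <= v -> v <= x -> (forall w, u <= w <= v -> m <= w * stein x w) ->
    (v - u) * (m + 1 - Phi x) <= stein x v - stein x u.
  move=> uv vx h; have [c [cuv]] := mvt_derive uv (is_derive_left x).
  have := h c cuv; rewrite !stein_left; try lra.
  by rewrite /left_branch => hc ->; nra.
have rgt u v : u <= v -> x <= u -> (forall w, u <= w <= v -> m <= w * stein x w) ->
    (v - u) * (m - Phi x) <= stein x v - stein x u.
  move=> uv vx h; have [c [cuv]] := mvt_derive uv (is_derive_right x).
  have := h c cuv; rewrite !stein_right; try lra.
  by rewrite /right_branch => hc ->; nra.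
move=> ab h; have [bx|xb] := Rle_lt_dec b x.
  by rewrite indle_true; [apply: lft | lra].
rewrite indle_false //.
have [ax|xa] := Rle_lt_dec a x; last first.
  by have := rgt a b ab ltac:(lra) h; lra.
have l := lft a x ax (Rle_refl x) (fun w hw => h w ltac:(lra)).
have r := rgt x b ltac:(lra) (Rle_refl x) (fun w hw => h w ltac:(lra)).
nra.
Qed.

(** On each branch the derivative of w f(w) is f + w f', with |f| <= 2, |f'| <= 2 and |w| <= B. *)
Lemma mul_stein_lipschitz x a b B : a <= b -> - B <= a -> b <= B ->
  Rabs (b * stein x b - a * stein x a) <= (b - a) * (2 + 2 * B).
Proof.
have lft u v : u <= v -> v <= x -> - B <= u -> v <= B ->
    Rabs (v * stein x v - u * stein x u) <= (v - u) * (2 + 2 * B).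
  move=> uv vx h1 h2.
  have [c [cuv]] := mvt_derive uv (fun t => is_derive_mul_id (is_derive_left x t)).
  have := stein_ge0_le2 x c; have := mul_stein_bounds x c.
  have := Phi_ge0 x; have := Phi_le1 x.
  rewrite !stein_left; try lra.
  rewrite /left_branch => p1 p0 hc h0 ->.
  rewrite Rabs_mult (Rabs_pos_eq (v - u)); last lra.
  rewrite Rmult_comm; apply: Rmult_le_compat_l; first lra.
  by apply: Rabs_le; nra.
have rgt u v : u <= v -> x <= u -> - B <= u -> v <= B ->
    Rabs (v * stein x v - u * stein x u) <= (v - u) * (2 + 2 * B).
  move=> uv vx h1 h2.
  have [c [cuv]] := mvt_derive uv (fun t => is_derive_mul_id (is_derive_right x t)).
  have := stein_ge0_le2 x c; have := mul_stein_bounds x c.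
  have := Phi_ge0 x; have := Phi_le1 x.
  rewrite !stein_right; try lra.
  rewrite /right_branch => p1 p0 hc h0 ->.
  rewrite Rabs_mult (Rabs_pos_eq (v - u)); last lra.
  rewrite Rmult_comm; apply: Rmult_le_compat_l; first lra.
  by apply: Rabs_le; nra.
move=> ab h1 h2; have [bx|xb] := Rle_lt_dec b x; first exact: lft.
have [ax|xa] := Rle_lt_dec a x; last by apply: rgt; lra.
have l := lft a x ax (Rle_refl x) h1 ltac:(lra).
have r := rgt x b ltac:(lra) (Rle_refl x) ltac:(lra) h2.
have -> : b * stein x b - a * stein x a =
  (b * stein x b - x * stein x x) + (x * stein x x - a * stein x a) by ring.
apply: Rle_trans; first exact: Rabs_triang.
lra.
Qed.

Lemma mul_stein_near x y w d : 0 <= d <= 1 -> Rabs (w - y) <= d ->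
  Rabs (w * stein x w - y * stein x y) <= d * (4 + 2 * Rabs y).
Proof.
move=> d01 /Rabs_le_between wy.
have b := Rabs_le_between y (Rabs y); have {b} [b1 b2] := proj1 b (Rle_refl _).
have y0 := Rabs_pos y.
have [yw|wy'] := Rle_lt_dec y w.
  have := @mul_stein_lipschitz x y w (Rabs y + d) yw ltac:(lra) ltac:(lra); nra.
have := @mul_stein_lipschitz x w y (Rabs y + d) ltac:(lra) ltac:(lra) ltac:(lra).
by rewrite Rabs_minus_sym; nra.
Qed.

End Stein.

(** * Berry-Esseen bound for weighted Bernoulli sums *)

Section BerryEsseen.

Local Open Scope R_scope.

Variables p a : nat -> R.
Hypothesis p01 : forall i, 0 <= p i <= 1.

(* [bernE n phi] is the expectation of [phi] at the centred sum of the [a i * (xi_i - p i)], [i <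
   n], for independent Bernoulli([p i]) variables [xi_i]. *)
Fixpoint bernE (n : nat) (phi : R -> R) : R :=
  if n is m.+1 then
    p m * bernE m (fun y => phi (y + (1 - p m) * a m))
    + (1 - p m) * bernE m (fun y => phi (y - p m * a m))
  else phi 0.

Fixpoint bern_var (n : nat) : R :=
  if n is m.+1 then bern_var m + p m * (1 - p m) * a m ^ 2 else 0.

Lemma bernE_le n (f g : R -> R) : (forall y, f y <= g y) -> bernE n f <= bernE n g.
Proof.
elim: n f g => [|n IH] f g le_fg /=; first exact: le_fg.
have [p0 p1] := p01 n.
by apply: Rplus_le_compat; apply: Rmult_le_compat_l; try lra; apply: IH.
Qed.

Lemma bernE_ext n (f g : R -> R) : (forall y, f y = g y) -> bernE n f = bernE n g.
Proof. by move=> e; apply: Rle_antisym; apply: bernE_le => y; rewrite e; apply: Rle_refl. Qed.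

Lemma bernE_lin n c (f g : R -> R) :
  bernE n (fun y => c * f y + g y) = c * bernE n f + bernE n g.
Proof.
elim: n f g => [//|n IH] f g /=.
rewrite (IH (fun y => f (y + (1 - p n) * a n)) (fun y => g (y + (1 - p n) * a n))).
rewrite (IH (fun y => f (y - p n * a n)) (fun y => g (y - p n * a n))).
ring.
Qed.

Lemma bernE_cst n c : bernE n (fun => c) = c.
Proof. by elim: n => [//|n /= ->]; ring. Qed.

Variable d : R.

(* For two-point variables the zero-bias identity writes [E (Y f(Y))] as a combination of
   difference quotients of [f] over intervals of length at most [d] near [Y]. *)
Lemma bernE_stein n (f h : R -> R) :
  (forall i, (i < n)%N -> 0 <= a i <= d) ->
  (forall u v y, u <= y <= v -> v - u <= d -> f v - f u <= (v - u) * h y) ->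
  bernE n (fun y => y * f y) <= bern_var n * bernE n h.
Proof.
elim: n f h => [|n IH] f h a0d fh /=; first lra.
have [p0 p1] := p01 n; have [a0 ad] := a0d n (ltnSn n).
set s := (1 - p n) * a n; set t := p n * a n.
pose f' y := p n * f (y + s) + (1 - p n) * f (y - t).
pose h' y := p n * h (y + s) + (1 - p n) * h (y - t).
have fh' u v y : u <= y <= v -> v - u <= d -> f' v - f' u <= (v - u) * h' y.
  move=> uyv uvd; rewrite /f' /h'.
  have h1 := fh (u + s) (v + s) (y + s) ltac:(lra) ltac:(lra).
  have h2 := fh (u - t) (v - t) (y - t) ltac:(lra) ltac:(lra).
  have := Rmult_le_compat_l _ _ _ p0 h1.
  have := Rmult_le_compat_l (1 - p n) _ _ ltac:(lra) h2.
  by lra.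
have {fh'} := IH f' h' (fun i lt_in => a0d i (ltnW lt_in)) fh'.
have eh' : bernE n h' =
    p n * bernE n (fun y => h (y + s)) + (1 - p n) * bernE n (fun y => h (y - t)).
  rewrite /h' bernE_lin; congr (_ + _).
  rewrite (bernE_ext _ (g := fun y => (1 - p n) * h (y - t) + 0)); last by move=> y; ring.
  by rewrite bernE_lin bernE_cst; ring.
rewrite -eh' => ih.
(* As p s = (1 - p) t = p (1 - p) a, the last variable contributes p (1 - p) a times the increment
   of f between its two outcomes. *)
have -> : p n * bernE n (fun y => (y + s) * f (y + s)) +
    (1 - p n) * bernE n (fun y => (y - t) * f (y - t)) =
    bernE n (fun y => 1 * (y * f' y) +
       (p n * (1 - p n) * a n * (f (y + s) - f (y - t)))).
  rewrite (bernE_ext _ (f := fun y => 1 * (y * f' y) +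
       (p n * (1 - p n) * a n * (f (y + s) - f (y - t))))
       (g := fun y => p n * ((y + s) * f (y + s)) +
       ((1 - p n) * ((y - t) * f (y - t)) + 0))).
    by rewrite !bernE_lin bernE_cst; ring.
  by move=> y; rewrite /f' /s /t; ring.
rewrite bernE_lin.
suff : bernE n (fun y => p n * (1 - p n) * a n * (f (y + s) - f (y - t))) <=
    p n * (1 - p n) * a n ^ 2 * bernE n h' by lra.
have -> : p n * (1 - p n) * a n ^ 2 * bernE n h' =
    bernE n (fun y => (p n * (1 - p n) * a n ^ 2) * h' y + 0).
  by rewrite bernE_lin bernE_cst; ring.
apply: bernE_le => y.
have st : s + t = a n by rewrite /s /t; ring.
have s0 : 0 <= s by rewrite /s; nra.
have t0 : 0 <= t by rewrite /t; nra.
(* The hypothesis holds at every y of the interval; taking both endpoints and averaging them with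
   weights p and 1 - p produces exactly [h' y]. *)
have h1 := fh (y - t) (y + s) (y + s) ltac:(lra) ltac:(lra).
have h2 := fh (y - t) (y + s) (y - t) ltac:(lra) ltac:(lra).
have e : y + s - (y - t) = a n by lra.
rewrite e in h1 h2.
have := Rmult_le_compat_l _ _ _ p0 h1.
have := Rmult_le_compat_l (1 - p n) _ _ ltac:(lra) h2.
move=> k1 k2.
have k : f (y + s) - f (y - t) <= a n * h' y by rewrite /h'; lra.
have q : 0 <= p n * (1 - p n) * a n.
  by apply: Rmult_le_pos => //; apply: Rmult_le_pos; lra.
have := Rmult_le_compat_l _ _ _ q k; rewrite /=; lra.
Qed.

Lemma bernE_sq_le n : (forall i, (i < n)%N -> 0 <= a i <= d) ->
  bernE n (fun y => y * y) <= bern_var n.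
Proof.
move=> a0d; have := @bernE_stein n (fun y => y) (fun => 1); rewrite bernE_cst Rmult_1_r.
by apply => // u v y; lra.
Qed.

(** This moment enters because the modulus of continuity in [mul_stein_near] grows with [Rabs y]. *)
Lemma bernE_abs_le n : (forall i, (i < n)%N -> 0 <= a i <= d) ->
  bernE n Rabs <= (1 + bern_var n) / 2.
Proof.
move=> a0d; apply: (Rle_trans _ (bernE n (fun y => / 2 * (y * y) + / 2))).
  apply: bernE_le => y; have <- : Rabs y * Rabs y = y * y.
    by rewrite -[RHS](Rabs_pos_eq (y * y)) ?Rabs_mult //; apply: Rle_0_sqr.
  have := Rle_0_sqr (Rabs y - 1); rewrite /Rsqr; lra.
by rewrite bernE_lin bernE_cst; have := bernE_sq_le a0d; lra.
Qed.

(** Shifting the threshold by d absorbs the unknown point within d of Y where the indicator is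
    evaluated. The bounds [up] and [lo] come from [stein z] and its negative; moving the threshold
    back costs d more by the Lipschitz bound on [Phi]. *)
Lemma berry_esseen n eta x : (forall i, (i < n)%N -> 0 <= a i <= d) ->
  0 <= d <= 1 -> eta <= / 2 -> Rabs (bern_var n - 1) <= eta ->
  Rabs (bernE n (fun y => indle y x) - Phi x) <= 8 * d + 2 * eta.
Proof.
move=> a0d [d0 d1] eta1 /Rabs_le_between hV.
pose P z := bernE n (fun y => indle y z).
pose F z := bernE n (fun y => y * stein z y).
have EA := bernE_abs_le a0d.
have EA0 : 0 <= bernE n Rabs.
  by rewrite -(bernE_cst n 0); apply: bernE_le; apply: Rabs_pos.
have Fb z : -1 <= F z <= 1.
  rewrite -(bernE_cst n (-1)) -(bernE_cst n 1).
  by split; apply: bernE_le => y; have := mul_stein_bounds z y; lra.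
(* The variance V lies in [1/2, 3/2], so E |Y| <= 5/4 and 7 d covers 4 d + 2 d E |Y|. Replacing V by
   1 costs at most eta / V <= 2 eta since |F z| <= 1. *)
have up z : Phi z - 7 * d - 2 * eta <= P (z + d).
  have [c ec] : exists c, c = 4 * d - Phi z by eexists.
  have := @bernE_stein n (stein z) (fun y => 1 * (y * stein z y) +
    (2 * d * Rabs y + (1 * indle y (z + d) + c))).
  rewrite !bernE_lin bernE_cst -/(F z) -/(P (z + d)) => /(_ a0d) h.
  have {h} : F z <= bern_var n * (1 * F z + (2 * d * bernE n Rabs + (1 * P (z + d) + c))).
    apply: h => u v y uyv uvd; set M := y * stein z y + d * (4 + 2 * Rabs y).
    apply: (Rle_trans _ ((v - u) * (M + indle u z - Phi z))).
      apply: stein_incr_le; first lra.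
      move=> w uwv; have := @mul_stein_near z y w d ltac:(lra) ltac:(apply: Rabs_le; lra).
      by move/Rabs_le_between; rewrite /M; lra.
    apply: Rmult_le_compat_l; first lra.
    have : indle u z <= indle y (z + d) by apply: indle_mono; lra.
    by rewrite /M; lra.
  have := Fb z; set X := F z; set Y := P _; set A := bernE n Rabs in EA EA0 *.
  set V := bern_var n in hV EA *; move=> Xb h.
  have dA : d * A <= 5 / 4 * d by nra.
  have := Rmult_le_compat_l V _ _ ltac:(lra) dA; nra.
have lo z : P (z - d) <= Phi z + 7 * d + 2 * eta.
  have [c ec] : exists c, c = 4 * d + Phi z by eexists.
  have := @bernE_stein n (fun y => - stein z y) (fun y => (-1) * (y * stein z y) +
    (2 * d * Rabs y + ((-1) * indle y (z - d) + c))).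
  rewrite (bernE_ext _ (f := fun y => y * - stein z y)
     (g := fun y => (-1) * (y * stein z y) + 0)); last by move=> y; ring.
  rewrite !bernE_lin !bernE_cst -/(F z) -/(P (z - d)) => /(_ a0d) h.
  have {h} : (-1) * F z + 0 <= bern_var n * ((-1) * F z + (2 * d * bernE n Rabs + ((-1) * P (z - d) + c))).
    apply: h => u v y uyv uvd; set M := y * stein z y - d * (4 + 2 * Rabs y).
    have : (v - u) * (M + indle v z - Phi z) <= stein z v - stein z u.
      apply: stein_incr_ge; first lra.
      move=> w uwv; have := @mul_stein_near z y w d ltac:(lra) ltac:(apply: Rabs_le; lra).
      by move/Rabs_le_between; rewrite /M; lra.
    have : indle y (z - d) <= indle v z by apply: indle_mono; lra.
    move=> h1; have := Rmult_le_compat_l (v - u) _ _ ltac:(lra) h1.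
    by rewrite /M ec; lra.
  have := Fb z; set X := F z; set Y := P _; set A := bernE n Rabs in EA EA0 *.
  set V := bern_var n in hV EA *; move=> Xb h.
  have dA : d * A <= 5 / 4 * d by nra.
  have := Rmult_le_compat_l V _ _ ltac:(lra) dA; nra.
have u := up (x - d); have l := lo (x + d).
rewrite (_ : x - d + d = x) in u; last by ring.
rewrite (_ : x + d - d = x) in l; last by ring.
have := @Phi_lipschitz (x - d) x ltac:(lra); have := @Phi_lipschitz x (x + d) ltac:(lra).
rewrite /P in u l; move=> ? ?; apply: Rabs_le; lra.
Qed.

End BerryEsseen.

(** * The Feller coupling *)

Section FellerCoupling.

Local Open Scope R_scope.

Variable th : R.
Hypothesis th0 : 0 < th.

Definition fp (j : nat) : R := th / (th + INR j.+1).

Lemma fp_den j : 0 < th + INR j.+1.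
Proof. by have := pos_INR j.+1; lra. Qed.

Lemma fp_bounds j : 0 < fp j <= 1.
Proof.
have d := fp_den j; have h := pos_INR j.+1; split.
  exact: Rdiv_lt_0_compat.
apply: (Rmult_le_reg_r (th + INR j.+1)) => //.
by rewrite /fp /Rdiv Rmult_assoc Rinv_l; lra.
Qed.

Lemma fp01 j : 0 <= fp j <= 1.
Proof. by have := fp_bounds j; lra. Qed.

Lemma onem_fp j : 1 - fp j = INR j.+1 / (th + INR j.+1).
Proof. by rewrite /fp; have := fp_den j; move: (INR _) => x h; field; lra. Qed.

(* Feller coupling, read from right to left. Let [xi_1 = 1] and let [xi_q] be independent
   Bernoulli([th / (th + q - 1)]), so that [fp j] is the parameter at position [q = j + 2].
   [fellerE i l g] is the expectation of [g] at the list of spacings between successive ones when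
   positions [1 .. i + 1] remain to be read and the last one seen is at position [i + 1 + l]. *)
Fixpoint fellerE (i l : nat) (g : seq nat -> R) : R :=
  if i is j.+1 then
    fp j * fellerE j 1 (fun s => g (l :: s)) + (1 - fp j) * fellerE j l.+1 g
  else g [:: l].

Lemma fellerE_le i l (g h : seq nat -> R) : (0 < l)%N ->
  (forall s, sumn s = (i + l)%N -> all (leq 1) s -> s <> [::] -> g s <= h s) ->
  fellerE i l g <= fellerE i l h.
Proof.
elim: i l g h => [|i IH] l g h l0 gh /=.
  by apply: gh => //=; rewrite ?addn0 ?l0.
have [p0 p1] := fp01 i.
apply: Rplus_le_compat; apply: Rmult_le_compat_l; try lra.
  apply: IH => // s ss s1 _; apply: gh => //=; last by rewrite l0.
  by rewrite ss addn1 addnC.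
by apply: IH => // s ss s1 s0; apply: gh => //; rewrite ss addnS.
Qed.

Lemma fellerE_ext i l (g h : seq nat -> R) : (0 < l)%N ->
  (forall s, sumn s = (i + l)%N -> all (leq 1) s -> s <> [::] -> g s = h s) ->
  fellerE i l g = fellerE i l h.
Proof.
move=> l0 gh; apply: Rle_antisym; apply: fellerE_le => // s h1 h2 h3.
  by rewrite gh //; apply: Rle_refl.
by rewrite gh //; apply: Rle_refl.
Qed.

Lemma fellerE_lin i l c (g h : seq nat -> R) :
  fellerE i l (fun s => c * g s + h s) = c * fellerE i l g + fellerE i l h.
Proof.
elim: i l g h => [//|i IH] l g h /=.
by rewrite (IH 1%N (fun s => g (l :: s)) (fun s => h (l :: s))) IH; ring.
Qed.

Lemma fellerE_cst i l c : fellerE i l (fun => c) = c.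
Proof. by elim: i l => [//|i IH] l /=; rewrite !IH; ring. Qed.

Definition inc_head (s : seq nat) : seq nat :=
  if s is k :: t then k.+1 :: t else [::].

Lemma fellerE_inc_head i l g :
  fellerE i l (fun s => g (inc_head s)) = fellerE i l.+1 g.
Proof. by elim: i l g => [//|i IH] l g /=; rewrite -(IH l.+1). Qed.

(* One step of the Chinese restaurant process on a list of cycle lengths, before normalisation. *)
Fixpoint crp (g : seq nat -> R) (s : seq nat) : R :=
  if s is k :: t then INR k * g (k.+1 :: t) + crp (fun u => g (k :: u)) t
  else th * g [:: 1%N].

(* The same step when the first cycle is known to contain a block of [l] elements into which
   nothing is inserted. *)
Let crp_block (l : nat) (g : seq nat -> R) (s : seq nat) : R :=
  if s is k :: t then
    (INR k - INR l + 1) * g (k.+1 :: t) + crp (fun u => g (k :: u)) t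
  else 0.

(** The left side is [th + INR i.+1] times [fellerE i.+1 l g]: a Feller step adds position i + 2
    while the restaurant inserts anywhere, so the two agree only in law. The backward recursion from
    l = 1 reaches all l, hence the block of general length. *)
Lemma fellerE_crp_block i l g : (0 < l)%N ->
  th * fellerE i 1 (fun s => g (l :: s)) + INR i.+1 * fellerE i l.+1 g
  = fellerE i l (crp_block l g).
Proof.
elim: i l g => [|i IH] l g l0.
  by rewrite /=; ring.
rewrite [fellerE i.+1 1 _]/= [fellerE i.+1 l.+1 _]/= [fellerE i.+1 l _]/=.
pose G s := g (l :: s).
have e1 : fellerE i 1 (fun s => (INR l - INR l + 1) * g (l.+1 :: s) + crp G s) =
    fellerE i 1 (fun s => g (l.+1 :: s)) +
    (th * fellerE i 1 (fun s => G (1%N :: s)) + INR i.+1 * fellerE i 2 G).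
  rewrite fellerE_lin; congr (_ + _); first by ring.
  rewrite IH //; apply: fellerE_ext => // -[//|k t] _ _ _.
  by rewrite /crp_block /=; ring.
(* A block of l rather than l + 1 elements leaves one more place in the first cycle, which accounts
   for the extra term [g (inc_head s)]. *)
have e2 : fellerE i l.+1 (crp_block l g) =
    fellerE i l.+2 g +
    (th * fellerE i 1 (fun s => g (l.+1 :: s)) + INR i.+1 * fellerE i l.+2 g).
  rewrite -[X in X + _]Rmult_1_l IH // -(fellerE_inc_head i l.+1 g) -fellerE_lin.
  apply: fellerE_ext => // -[//|k t] _ _ _.
  by rewrite /crp_block (S_INR l) /inc_head; ring.
rewrite /G in e1; rewrite e1 e2 onem_fp /fp (S_INR i.+1).
by have := fp_den i; move: (INR i.+1) => x h; field; lra.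
Qed.

Lemma fellerE_crp i g : fellerE i.+1 1 g = fellerE i 1 (crp g) / (th + INR i.+1).
Proof.
have -> : fellerE i 1 (crp g) = fellerE i 1 (crp_block 1 g).
  by apply: fellerE_ext => // -[//|k t] _ _ _; rewrite /crp_block /=; ring.
rewrite -fellerE_crp_block // [LHS]/= onem_fp /fp.
by have := fp_den i; move: (INR i.+1) => x h; field; lra.
Qed.

(** Multiplicative functional of the spacings: [r] sees the position of the right end of a spacing
    and its length. *)
Fixpoint weight (r : nat -> nat -> R) (s : seq nat) : R :=
  if s is k :: t then r (k + sumn t).+1 k * weight r t else 1.

Lemma weight_ge0 (r : nat -> nat -> R) s : (forall m k, 0 <= r m k) -> 0 <= weight r s.
Proof.
by move=> r0; elim: s => [|k t IH] /=; [lra | apply: Rmult_le_pos].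
Qed.

(** Supersolution principle. In state (i, l) the right end of the current spacing is the
    deterministic position i + l + 1, so its factor comes out of the expectation. *)
Lemma fellerE_weight_le (r K : nat -> nat -> R) i l :
  (forall m k, 0 <= r m k) ->
  (forall k, (0 < k)%N -> r k.+1 k <= K 0%N k) ->
  (forall j k, (0 < k)%N ->
     fp j * r (j + k).+2 k * K j 1%N + (1 - fp j) * K j k.+1 <= K j.+1 k) ->
  (0 < l)%N -> fellerE i l (weight r) <= K i l.
Proof.
move=> r0 K0 KS; elim: i l => [|i IH] l l0 /=.
  by rewrite addn0 Rmult_1_r; apply: K0.
apply: Rle_trans (KS i l l0); have p := fp01 i.
apply: Rplus_le_compat; last by apply: Rmult_le_compat_l; [lra | apply: IH].
rewrite Rmult_assoc; apply: Rmult_le_compat_l; first lra.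
have -> : fellerE i 1 (fun s => r (l + sumn s).+1 l * weight r s) =
    r (i + l).+2 l * fellerE i 1 (weight r).
  rewrite (@fellerE_ext _ _ _ (fun s => r (i + l).+2 l * weight r s + 0)) //.
    by rewrite fellerE_lin fellerE_cst; ring.
  by move=> s -> _ _; rewrite addn1 addnS addnC Rplus_0_r.
by apply: Rmult_le_compat_l => //; apply: IH.
Qed.

(* On a list of spacings, [renewal_sum] is the sum of [ln q] over the positions [q] of the ones,
   and [log_ratio] the sum of [ln (p_(j+1) / (p_(j+1) - p_j))]. *)
Fixpoint renewal_sum (s : seq nat) : R :=
  if s is _ :: t then ln (INR (sumn t).+1) + renewal_sum t else 0.

Fixpoint log_prod (s : seq nat) : R :=
  if s is k :: t then ln (INR k) + log_prod t else 0.

Fixpoint log_ratio (s : seq nat) : R :=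
  if s is k :: t then ln (INR (k + sumn t).+1) - ln (INR k) + log_ratio t else 0.

(** Each length is its right end divided by the ratio, and the right end of a spacing is the left
    end of the one before it in the list; only the outermost right end is left over. *)
Lemma log_prodE s :
  log_prod s = ln (INR (sumn s).+1) + renewal_sum s - log_ratio s.
Proof.
elim: s => [|k t IH]; first by rewrite /= ln_1; ring.
change (ln (INR k) + log_prod t =
  ln (INR (k + sumn t).+1) + (ln (INR (sumn t).+1) + renewal_sum t) -
  (ln (INR (k + sumn t).+1) - ln (INR k) + log_ratio t)).
by rewrite IH; ring.
Qed.

Fixpoint renewal_mean (n : nat) : R :=
  if n is m.+1 then renewal_mean m + fp m * ln (INR m.+2) else 0.

(** A one at position q adds ln q whatever the spacings around it, so the sum is over independent
    variables. Position 1 always holds a one and adds ln 1 = 0. *)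
Lemma fellerE_renewal_sum i l (phi : R -> R) sg : (0 < l)%N -> sg <> 0 ->
  fellerE i l (fun s => phi (renewal_sum s)) =
  bernE fp (fun j => ln (INR j.+2) / sg) i (fun y => phi (sg * y + renewal_mean i)).
Proof.
move=> l0 sg0; elim: i l phi l0 => [|i IH] l phi l0.
  by rewrite /= ln_1; congr phi; ring.
rewrite [LHS]/= [RHS]/=; congr (_ * _ + _ * _); last first.
  by rewrite IH //; apply: bernE_ext => [|y]; [exact: fp01 | congr phi; field].
rewrite (@fellerE_ext _ _ _ (fun s => phi (ln (INR i.+2) + renewal_sum s))) //; last first.
  by move=> s -> _ _; rewrite addn1.
rewrite (IH 1%N (fun z => phi (ln (INR i.+2) + z))) //.
by apply: bernE_ext => [|y]; [exact: fp01 | congr phi; rewrite -/(INR i.+2); field].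
Qed.

End FellerCoupling.

(** * Exponential moments of the spacings *)

Section FellerMoments.

Local Open Scope R_scope.

Variable th : R.
Hypothesis th0 : 0 < th.

Lemma fp_le j : fp th j <= (1 + th) / INR j.+2.
Proof.
have d := fp_den th0 j; have j0 := pos_INR j.
rewrite /fp; rewrite !S_INR in d *.
apply: (Rmult_le_reg_r ((th + (INR j + 1)) * (INR j + 1 + 1))); first by nra.
have -> : th / (th + (INR j + 1)) * ((th + (INR j + 1)) * (INR j + 1 + 1)) =
  th * (INR j + 1 + 1) by field; lra.
have -> : (1 + th) / (INR j + 1 + 1) * ((th + (INR j + 1)) * (INR j + 1 + 1)) =
  (1 + th) * (th + (INR j + 1)) by field; lra.
nra.
Qed.

Lemma ln_le_mono x y : 0 < x -> x <= y -> ln x <= ln y.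
Proof.
by move=> x0 [xy|->]; [apply/Rlt_le/ln_increasing | apply: Rle_refl].
Qed.

Lemma INR_S_gt0 n : 0 < INR n.+1.
Proof. by have := pos_INR n; rewrite S_INR; lra. Qed.

Lemma ln_INR_S_ge0 n : 0 <= ln (INR n.+1).
Proof.
rewrite -ln_1; apply: ln_le_mono; first lra.
by have := pos_INR n; rewrite S_INR; lra.
Qed.

Lemma ln_succ_ge n : / INR n.+2 <= ln (INR n.+2) - ln (INR n.+1).
Proof.
have p1 := INR_S_gt0 n; have p2 := INR_S_gt0 n.+1.
have e : INR n.+1 / INR n.+2 = 1 - / INR n.+2.
  by rewrite (S_INR n.+1) in p2 *; field; lra.
rewrite -ln_div // -[ln _]Ropp_involutive -ln_Rinv; last exact: Rdiv_lt_0_compat.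
rewrite Rinv_div e.
have q : 0 < 1 - / INR n.+2 by rewrite -e; exact: Rdiv_lt_0_compat.
by have := exp_ineq1_le (ln (1 - / INR n.+2)); rewrite exp_ln //; lra.
Qed.

Lemma ln_succ_le n : ln (INR n.+2) - ln (INR n.+1) <= / INR n.+1.
Proof.
have p1 := INR_S_gt0 n; have p2 := INR_S_gt0 n.+1.
have e : INR n.+2 / INR n.+1 = 1 + / INR n.+1.
  by rewrite (S_INR n.+1); field; lra.
rewrite -ln_div // e.
have q : 0 < 1 + / INR n.+1 by rewrite -e; exact: Rdiv_lt_0_compat.
by have := exp_ineq1_le (ln (1 + / INR n.+1)); rewrite exp_ln //; lra.
Qed.

(** Each position multiplies the mean by 1 + [fp th j], which is at most the growth of the (1 +
    th)-th power from j + 1 to j + 2. *)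
Lemma fellerE_pow2_size i :
  fellerE th i 1 (weight (fun _ _ => 2)) <= 2 * exp ((1 + th) * ln (INR i.+1)).
Proof.
apply: (fellerE_weight_le th0
  (K := fun i _ => 2 * exp ((1 + th) * ln (INR i.+1)))) => //.
- by move=> _ _; lra.
- by move=> _ _; rewrite ln_1 Rmult_0_r exp_0; lra.
move=> j _ _; have := exp_pos ((1 + th) * ln (INR j.+1)).
set E := exp _ => E0.
have -> : fp th j * 2 * (2 * E) + (1 - fp th j) * (2 * E) = 2 * (E * (1 + fp th j)).
  by ring.
apply: Rmult_le_compat_l; first lra.
have -> : exp ((1 + th) * ln (INR j.+2)) =
    E * exp ((1 + th) * (ln (INR j.+2) - ln (INR j.+1))).
  by rewrite /E -exp_plus; congr exp; ring.
apply: Rmult_le_compat_l; first lra.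
apply: Rle_trans (exp_ineq1_le _).
apply: Rplus_le_compat_l; apply: Rle_trans (fp_le j) _.
by apply: Rmult_le_compat_l; [lra | apply: ln_succ_ge].
Qed.

Let root_ratio (m k : nat) : R := sqrt (INR m) / sqrt (INR k).

Let root_ratio_ge0 m k : 0 <= root_ratio m k.
Proof.
(* Division by zero gives 0 at k = 0. *)
case: k => [|k].
  by rewrite /root_ratio sqrt_0 /Rdiv Rinv_0 Rmult_0_r; apply: Rle_refl.
apply: Rmult_le_pos; first exact: sqrt_pos.
by apply/Rlt_le/Rinv_0_lt_compat/sqrt_lt_R0/INR_S_gt0.
Qed.

(** The divisor is 1 + 2 (1 + th), an upper bound for 1 + [compensator j 1], the potential from
    which a new spacing starts. *)
Definition spacing_weight (m k : nat) : R := root_ratio m k / (3 + 2 * th).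

(* The compensator of the jumps [root_ratio m k - 1] when no further one is met; it is bounded
   uniformly in [i] and [l]. *)
Let Fixpoint compensator (i l : nat) : R :=
  if i is j.+1 then
    compensator j l.+1 + fp th j * (root_ratio (j + l).+2 l - 1)
  else root_ratio l.+1 l - 1.

(** The right side is a difference in l, made to telescope in [compensator_bound]. It follows from c
    (c - b) <= c^2 - b^2 = q and 1 / b <= 2 (b - a), where a, b, c are the roots of l - 1, l, q +
    l. *)
Let root_ratio_bound q l : (0 < l)%N ->
  0 <= root_ratio (q + l) l - 1 /\
  sqrt (INR (q + l)) * (root_ratio (q + l) l - 1) <=
  2 * INR q * (sqrt (INR l) - sqrt (INR l.-1)).
Proof.
case: l => // l _; rewrite /root_ratio [l.+1.-1]/=.
have l0 := pos_INR l; have q0 := pos_INR q.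
rewrite plus_INR S_INR.
set x := INR l in l0 *; set y := INR q in q0 *.
have := sqrt_sqrt x l0; have := sqrt_sqrt (x + 1) ltac:(lra).
have := sqrt_sqrt (y + (x + 1)) ltac:(lra).
have s0 := sqrt_pos x; have s1 : 0 < sqrt (x + 1) by apply: sqrt_lt_R0; lra.
have s2 : sqrt (x + 1) <= sqrt (y + (x + 1)) by apply: sqrt_le_1_alt; lra.
have s3 : sqrt x <= sqrt (x + 1) by apply: sqrt_le_1_alt; lra.
move: (sqrt x) (sqrt (x + 1)) (sqrt (y + (x + 1))) s0 s1 s2 s3 => a b c a0 b0 bc ab cc bb aa.
have -> : c / b - 1 = (c - b) / b by field; lra.
split.
  by apply: Rmult_le_pos; [lra | apply/Rlt_le/Rinv_0_lt_compat].
have : 1 <= 2 * b * (b - a) by nra.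
have : c * (c - b) <= y by nra.
move=> h1 h2; apply: (Rmult_le_reg_r b) => //.
have -> : c * ((c - b) / b) * b = c * (c - b) by field; lra.
nra.
Qed.

(** The sum i + l is constant along the recursion, so the root in front is common to all terms;
    [fp_le] cancels the factor q = i + 2 of [root_ratio_bound], and the differences of roots
    telescope. *)
Let compensator_bound i l : (0 < l)%N ->
  0 <= compensator i l /\
  sqrt (INR (i + l).+1) * compensator i l <=
  2 * (1 + th) * (sqrt (INR (i + l).+1) - sqrt (INR l.-1)).
Proof.
elim: i l => [|i IH] l l0.
  have [h1 h2] := root_ratio_bound 1 l0; rewrite add1n /= -/(INR l.+1) in h1 h2 *.
  have h3 : sqrt (INR l) <= sqrt (INR l.+1).
    by apply: sqrt_le_1_alt; rewrite S_INR; lra.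
  have h4 : sqrt (INR l.-1) <= sqrt (INR l).
    by apply: sqrt_le_1_alt; apply: le_INR; apply/leP; apply: leq_pred.
  split => //; apply: Rle_trans h2 _; nra.
have [h1 h2] := IH l.+1 isT; have [h3 h4] := root_ratio_bound i.+2 l0.
have [p0 p1] := fp_bounds th0 i; have p := fp_le i.
rewrite /= -/(INR (i + l).+2).
rewrite addnS /= in h2; rewrite !addSn in h3 h4.
split; first by nra.
set M := sqrt (INR (i + l).+2) in h2 h4 *.
set A := root_ratio _ _ - 1 in h3 h4 *.
have q : fp th i * (M * A) <= 2 * (1 + th) * (sqrt (INR l) - sqrt (INR l.-1)).
  apply: (Rle_trans _ ((1 + th) / INR i.+2 * (2 * INR i.+2 * (sqrt (INR l) - sqrt (INR l.-1))))).
    apply: Rmult_le_compat => //; first lra.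
    by apply: Rmult_le_pos => //; apply: sqrt_pos.
  by apply: Req_le; field; have := INR_S_gt0 i.+1; lra.
lra.
Qed.

Let compensator_le i : compensator i 1 <= 2 * (1 + th).
Proof.
have [_] := compensator_bound i (isT : (0 < 1)%N).
rewrite /= sqrt_0 Rminus_0_r Rmult_comm => h.
apply: Rmult_le_reg_r h; apply: sqrt_lt_R0; exact: INR_S_gt0.
Qed.

(** The divisor absorbs the potential [1 + compensator j 1] of a restart, reducing the
    multiplicative recursion to the additive one that defines [compensator]. *)
Lemma fellerE_spacing_weight i :
  fellerE th i 1 (weight spacing_weight) <= 3 + 2 * th.
Proof.
have r0 m k : 0 <= spacing_weight m k.
  apply: Rmult_le_pos; first exact: root_ratio_ge0.
  by apply/Rlt_le/Rinv_0_lt_compat; lra.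
apply: (Rle_trans _ (1 + compensator i 1)); last by have := compensator_le i; lra.
apply: (fellerE_weight_le th0 (K := fun i l => 1 + compensator i l)) => //.
  move=> k k0 /=.
  have := root_ratio_ge0 k.+1 k; rewrite /spacing_weight.
  set x := root_ratio _ _ => x0.
  apply: (Rmult_le_reg_r (3 + 2 * th)); first lra.
  have -> : x / (3 + 2 * th) * (3 + 2 * th) = x by field; lra.
  nra.
move=> j k k0 /=; have [p0 p1] := fp_bounds th0 j.
have := root_ratio_ge0 (j + k).+2 k; rewrite /spacing_weight.
set x := root_ratio _ _ => x0.
have [y0 _] := compensator_bound j (isT : (0 < k.+1)%N).
have y1 := compensator_le j.
have h : x / (3 + 2 * th) * (1 + compensator j 1) <= x.
  have {2}-> : x = x / (3 + 2 * th) * (3 + 2 * th) by field; lra.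
  apply: Rmult_le_compat_l; last lra.
  by apply: Rmult_le_pos => //; apply/Rlt_le/Rinv_0_lt_compat; lra.
have := Rmult_le_compat_l _ _ _ (Rlt_le _ _ p0) h; nra.
Qed.

(* The probability that position [q] holds a one. *)
Let one_prob (q : nat) : R :=
  match q with 0 => 0 | 1 => 1 | j.+2 => fp th j end.

Let one_prob01 q : 0 <= one_prob q <= 1.
Proof. by case: q => [|[|q]] /=; [split; lra | split; lra | apply: fp01]. Qed.

Let one_prob_le q : one_prob q.+1 <= (1 + th) / INR q.+1.
Proof. by case: q => [|q] /=; [lra | apply: fp_le]. Qed.

(* The potential used for the number of spacings equal to [k] accounts for the pairs of ones at
   distance [k] still to come and for the one that would complete such a pair with the last one
   seen. *)
Let Fixpoint pair_prod (k i : nat) : R :=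
  if i is j.+1 then pair_prod k j * (1 + 2 * fp th j * one_prob (j.+2 - k))
  else 1.

(** With t = i + 1 - k, the new factor exceeds 1 by at most 2 (1 + th)^2 / ((t + 1) (t + 2)), a
    telescoping term; hence a bound uniform in k and i. *)
Let pair_prod_bounds k i : (0 < k)%N ->
  0 < pair_prod k i <= exp (2 * (1 + th) ^ 2 * (2 - / INR (i.+1 - k).+1)).
Proof.
move=> k0; have sq : 0 <= 2 * (1 + th) ^ 2 by have := pow2_ge_0 (1 + th); lra.
elim: i => [|i [IH0 IH]].
  split; first by rewrite /=; lra.
  apply: (Rle_trans _ (exp 0)); first by rewrite exp_0; apply: Rle_refl.
  apply: exp_le_mono; apply: Rmult_le_pos => //.
  have := INR_S_gt0 (1 - k) => h.
  have : / INR (1 - k).+1 <= / 1.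
    apply: Rinv_le_contravar; first lra.
    by have := pos_INR (1 - k); rewrite S_INR; lra.
  lra.
rewrite [pair_prod k i.+1]/=.
have [p0 p1] := fp_bounds th0 i; have [q0 q1] := one_prob01 (i.+2 - k).
split; first by apply: Rmult_lt_0_compat => //; nra.
(* For i + 2 <= k the truncated difference is 0, where [one_prob] vanishes, and neither side
   changes. *)
case: (leqP i.+2 k) => ik.
  have e1 : (i.+2 - k = 0)%N by apply/eqP; rewrite subn_eq0.
  have e2 : (i.+1 - k = 0)%N by apply/eqP; rewrite subn_eq0 ltnW.
  by rewrite e1 e2 /= in IH *; rewrite Rmult_0_r Rplus_0_r Rmult_1_r.
have e : (i.+2 - k = (i.+1 - k).+1)%N by rewrite subSn.
rewrite e in q0 q1 *; set t := (i.+1 - k)%N in IH q0 q1 *.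
have ti : (t <= i)%N by rewrite /t leq_subLR -add1n leq_add2r.
have -> : exp (2 * (1 + th) ^ 2 * (2 - / INR t.+2)) =
  exp (2 * (1 + th) ^ 2 * (2 - / INR t.+1)) *
  exp (2 * (1 + th) ^ 2 * (/ INR t.+1 - / INR t.+2)).
  by rewrite -exp_plus; congr exp; ring.
apply: Rmult_le_compat => //; [lra | by nra |].
apply: Rle_trans (exp_ineq1_le _); apply: Rplus_le_compat_l.
have t1 := INR_S_gt0 t; have t2 := INR_S_gt0 t.+1.
have -> : / INR t.+1 - / INR t.+2 = / INR t.+2 * / INR t.+1.
  rewrite (S_INR t.+1) in t2 *; move: (INR t.+1) t1 t2 => x x0 x1.
  by field; split; lra.
have a1 := one_prob_le t.
have a2 : fp th i <= (1 + th) * / INR t.+2.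
  apply: Rle_trans (fp_le i) _; apply: Rmult_le_compat_l; first lra.
  by apply: Rinv_le_contravar => //; apply: le_INR; apply/leP.
have := Rmult_le_compat _ _ _ _ (Rlt_le _ _ p0) q0 a2 a1.
rewrite /Rdiv; lra.
Qed.

Let double (k m l : nat) : R := if l == k then 2 else 1.

Lemma weight_double k s : weight (double k) s = 2 ^ count_mem k s.
Proof.
elim: s => [//|l s IH] /=; rewrite IH /double.
by case: eqP => _; rewrite ?add1n ?add0n /=; ring.
Qed.

Lemma fellerE_pow2_count k i : (0 < k)%N ->
  fellerE th i 1 (fun s => 2 ^ count_mem k s) <= 2 * exp (4 * (1 + th) ^ 2).
Proof.
move=> k0.
(* The current spacing ends at i + 1 + l, so it has length k only if position i + 1 + l - k holds a
   one. *)
pose K i l := pair_prod k i * (1 + (if (l <= k)%N then one_prob (i.+1 + l - k) else 0)).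
apply: (Rle_trans _ (K i 1%N)); last first.
  have [h0 h1] := pair_prod_bounds i k0.
  have h2 : pair_prod k i <= exp (4 * (1 + th) ^ 2).
    apply: Rle_trans h1 _; apply: exp_le_mono.
    have : 0 < / INR (i.+1 - k).+1 by apply: Rinv_0_lt_compat; apply: INR_S_gt0.
    have := pow2_ge_0 (1 + th); move: ((1 + th) ^ 2) (/ _) => x y x0 y0; nra.
  have [h3 h4] := one_prob01 (i.+1 + 1 - k).
  rewrite /K k0; move: (one_prob _) h3 h4 => x x0 x1.
  by change (pair_prod k i * (1 + x) <= 2 * exp (4 * (1 + th) ^ 2)); nra.
apply: (Rle_trans _ (fellerE th i 1 (weight (double k)))).
  by apply: fellerE_le => // s _ _ _; rewrite weight_double; apply: Rle_refl.
apply: fellerE_weight_le => //.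
- by move=> m l; rewrite /double; case: eqP => _; lra.
- move=> l l0; rewrite /K /double /=.
  have [->|lk] := eqVneq l k; first by rewrite leqnn addnK /=; lra.
  by case: leqP => _; have := one_prob01 (1 + l - k); lra.
move=> j l l0; rewrite /K /double k0 [pair_prod k j.+1]/= addn1.
have [H0 _] := pair_prod_bounds j k0; set H := pair_prod k j in H0 *.
have [p0 p1] := fp01 th0 j; have [q0 q1] := one_prob01 (j.+2 - k).
set e' := one_prob _ in q0 q1 *; set P := fp th j in p0 p1 *.
have [->|lk] := eqVneq l k.
  rewrite leqnn ltnn addnK /= -/P; have pe : 0 <= P * e' by nra.
  have : P * 2 * (1 + e') + (1 - P) <= (1 + 2 * P * e') * (1 + P) by nra.
  nra.
have e : (j.+1 + l.+1 - k = j.+2 + l - k)%N by rewrite addnS.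
case: (ltnP l k) => lk'.
  rewrite (ltnW lk') e; have [] := one_prob01 (j.+2 + l - k).
  set x := one_prob _ => x0 x1; have : 0 <= P * e' by nra.
  move=> pe; have : P * 1 * (1 + e') + (1 - P) * (1 + x) <= (1 + 2 * P * e') * (1 + x).
    have pex : 0 <= P * e' * x by apply: Rmult_le_pos.
    have px : 0 <= P * x by apply: Rmult_le_pos.
    by lra.
  nra.
have -> : (l <= k)%N = false by apply/negbTE; rewrite -ltnNge ltn_neqAle eq_sym lk lk'.
have : 0 <= P * e' by nra.
nra.
Qed.

End FellerMoments.

(** * Cycle types under the Ewens measure *)

Section EwensCrp.

Import GRing.Theory Num.Theory.
Local Open Scope ring_scope.

Lemma porbit_sub_stable (T : finType) (s : {perm T}) (A : {set T}) x :
  x \in A -> (forall y, y \in A -> s y \in A) -> porbit s x \subset A.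
Proof.
move=> xA sA; apply/subsetP => y /porbitP [i ->].
by elim: i => [|i IH]; rewrite ?expg0 ?perm1 // expgSr permM; apply: sA.
Qed.

Lemma porbit_step (T : finType) (s : {perm T}) x y :
  y \in porbit s x -> s y \in porbit s x.
Proof.
by move=> /porbitP [i ->]; rewrite -permM -expgSr; apply: mem_porbit.
Qed.

(** The order is that of [enum], hence the restriction to [perm_invariant] functionals below. *)
Definition cycle_type (n : nat) (s : 'S_n) : seq nat :=
  map (fun C : {set 'I_n} => #|C|) (enum (porbits s)).

Section Insertion.

Variables (n : nat) (t : 'S_n).

Let h : 'I_n -> 'I_n.+1 := lift ord_max.

(* Insert the new point [ord_max] just after [j] in its cycle, or as a fixed point if [j] is
   [ord_max] itself. *)
Definition insert_perm (j : 'I_n.+1) : 'S_n.+1 :=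
  (tperm j ord_max * lift_perm ord_max ord_max t)%g.

Let insert_pre j : insert_perm j j = ord_max.
Proof. by rewrite /insert_perm permM tpermL lift_perm_id. Qed.

Let insert_max x : insert_perm (h x) ord_max = h (t x).
Proof. by rewrite /insert_perm permM tpermR lift_perm_lift. Qed.

Let insert_other j x : h x != j -> insert_perm j (h x) = h (t x).
Proof.
move=> xj; rewrite /insert_perm permM tpermD ?lift_perm_lift //.
  by rewrite eq_sym.
by rewrite neq_lift.
Qed.

Let h_inj : injective h.
Proof. exact: lift_inj. Qed.

Let h_neq_max x : h x == ord_max = false.
Proof. by rewrite eq_sym; apply/negbTE/neq_lift. Qed.

Let max_notin (A : {set 'I_n}) : ord_max \notin h @: A.
Proof. by apply/imsetP => -[x _ /eqP]; rewrite eq_sym h_neq_max. Qed.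

Let porbit_insert_sup j x y :
  y \in porbit t x -> h y \in porbit (insert_perm j) (h x).
Proof.
move=> yx; suff /subsetP /(_ y yx) : porbit t x \subset
    [set z | h z \in porbit (insert_perm j) (h x)] by rewrite inE.
apply: porbit_sub_stable => [|z]; rewrite !inE ?porbit_id // => zx.
(* If [h z] is j, the new cycle reaches [h (t z)] by a detour through [ord_max]. *)
have [e|ne] := eqVneq (h z) j; last by rewrite -(insert_other ne); apply: porbit_step.
rewrite -[h (t z)]insert_max e; apply: porbit_step.
by rewrite -[ord_max](insert_pre j) -{2}e; apply: porbit_step.
Qed.

Let porbit_insert_fix y : porbit (insert_perm ord_max) (h y) = h @: porbit t y.
Proof.
apply/eqP; rewrite eqEsubset; apply/andP; split; last first.
  by apply/subsetP => _ /imsetP [x xy ->]; apply: porbit_insert_sup.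
apply: porbit_sub_stable; first by rewrite imset_f ?porbit_id.
move=> _ /imsetP [z zy ->]; rewrite insert_other ?h_neq_max //.
by rewrite imset_f // porbit_step.
Qed.

Let porbit_insert_fix_max : porbit (insert_perm ord_max) ord_max = [set ord_max].
Proof.
apply/eqP; rewrite eqEsubset sub1set porbit_id andbT.
apply: porbit_sub_stable; rewrite ?set11 // => y /set1P ->.
by rewrite insert_pre set11.
Qed.

Let porbit_insert_out x y : y \notin porbit t x ->
  porbit (insert_perm (h x)) (h y) = h @: porbit t y.
Proof.
move=> yx; apply/eqP; rewrite eqEsubset; apply/andP; split; last first.
  by apply/subsetP => _ /imsetP [z zy ->]; apply: porbit_insert_sup.
apply: porbit_sub_stable; first by rewrite imset_f ?porbit_id.
move=> _ /imsetP [z zy ->]; rewrite insert_other.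
  by rewrite imset_f // porbit_step.
apply: contra yx => /eqP /h_inj zx.
by rewrite porbit_sym -zx.
Qed.

Let porbit_insert_in x y : y \in porbit t x ->
  porbit (insert_perm (h x)) (h y) = ord_max |: h @: porbit t x.
Proof.
move=> yx; have -> : porbit (insert_perm (h x)) (h y) = porbit (insert_perm (h x)) (h x).
  by apply/eqP; rewrite eq_porbit_mem; apply: porbit_insert_sup.
apply/eqP; rewrite eqEsubset; apply/andP; split; last first.
  rewrite subUset sub1set; apply/andP; split.
    by rewrite -(insert_pre (h x)) porbit_step // porbit_id.
  by apply/subsetP => _ /imsetP [z zy ->]; apply: porbit_insert_sup.
apply: porbit_sub_stable; first by rewrite inE imset_f ?porbit_id ?orbT.
move=> z /setU1P [->|/imsetP [{}z zx ->]].
  by rewrite insert_max inE imset_f ?orbT // porbit_step // porbit_id.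
have [/h_inj ->|ne] := eqVneq (h z) (h x); first by rewrite insert_pre setU11.
by rewrite insert_other // inE imset_f ?orbT // porbit_step.
Qed.

Let porbit_insert_max x :
  porbit (insert_perm (h x)) ord_max = ord_max |: h @: porbit t x.
Proof.
rewrite -(@porbit_insert_in x x) ?porbit_id //; apply/eqP.
by rewrite eq_porbit_mem -(insert_pre (h x)) porbit_step // porbit_id.
Qed.

Let him_inj : injective (fun C : {set 'I_n} => h @: C).
Proof. exact: imset_inj. Qed.

Let perm_enum_setU1 (T : finType) (a : T) (B : {set T}) :
  a \notin B -> perm_eq (enum (a |: B)) (a :: enum B).
Proof.
move=> aB; apply: uniq_perm; rewrite /= ?enum_uniq ?mem_enum ?aB //.
by move=> x; rewrite in_cons !mem_enum !inE.
Qed.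

Let perm_enum_imset (B : {set {set 'I_n}}) :
  perm_eq (enum [set h @: (C : {set 'I_n}) | C in B])
    [seq h @: (C : {set 'I_n}) | C <- enum B].
Proof.
apply: uniq_perm; rewrite ?enum_uniq ?(map_inj_uniq him_inj) ?enum_uniq //.
move=> D; rewrite mem_enum; apply/imsetP/mapP => -[C CB ->];
  by exists C; rewrite // ?mem_enum // -mem_enum.
Qed.

Let card_h (B : {set {set 'I_n}}) :
  map (fun D : {set 'I_n.+1} => #|D|) [seq h @: (C : {set 'I_n}) | C <- enum B] =
  map (fun C : {set 'I_n} => #|C|) (enum B).
Proof. by rewrite -map_comp; apply: eq_map => C; rewrite /= card_imset. Qed.

Lemma cycle_type_insert_fix :
  perm_eq (cycle_type (insert_perm ord_max)) (1%N :: cycle_type t).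
Proof.
have e : porbits (insert_perm ord_max) =
    [set ord_max] |: [set h @: (C : {set 'I_n}) | C in porbits t].
  apply/setP => D; apply/imsetP/setU1P.
    case=> z _ ->; case: (unliftP ord_max z) => [y|] ->.
      by right; rewrite porbit_insert_fix imset_f // imset_f.
    by left; apply: porbit_insert_fix_max.
  case=> [->|/imsetP [_ /imsetP [y _ ->] ->]].
    by exists ord_max; rewrite ?porbit_insert_fix_max.
  by exists (h y); rewrite ?porbit_insert_fix.
rewrite /cycle_type e.
have /perm_map/perm_trans -> // :
    perm_eq (enum ([set ord_max] |: [set h @: (C : {set 'I_n}) | C in porbits t]))
      ([set ord_max] :: enum [set h @: (C : {set 'I_n}) | C in porbits t]).
  apply: perm_enum_setU1; apply/imsetP => -[C _ eC].
  by have := max_notin C; rewrite -eC set11.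
rewrite /= cards1 perm_cons -card_h; apply: perm_map.
exact: perm_enum_imset.
Qed.

Lemma cycle_type_insert x :
  perm_eq (cycle_type (insert_perm (lift ord_max x)))
    (#|porbit t x|.+1 :: rem #|porbit t x| (cycle_type t)).
Proof.
set C0 := porbit t x; set A := ord_max |: h @: C0; set B := porbits t :\ C0.
have e : porbits (insert_perm (h x)) = A |: [set h @: (C : {set 'I_n}) | C in B].
  apply/setP => D; apply/imsetP/setU1P.
    case=> z _ ->; case: (unliftP ord_max z) => [y|] ->; last first.
      by left; rewrite porbit_insert_max.
    have [yx|yx] := boolP (y \in C0); first by left; apply: porbit_insert_in.
    right; rewrite porbit_insert_out // imset_f // !inE.
    by rewrite /C0 eq_porbit_mem yx imset_f.
  case=> [->|/imsetP [C]]; first by exists ord_max; rewrite ?porbit_insert_max.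
  rewrite !inE => /andP [CC0 /imsetP [y _ Cy]] ->; exists (h y) => //.
  by rewrite Cy porbit_insert_out // -eq_porbit_mem -Cy.
have ct : perm_eq (cycle_type t) (#|C0| :: map (fun C : {set 'I_n} => #|C|) (enum B)).
  have C0t : C0 \in porbits t by apply: imset_f.
  suff /(perm_map (fun C : {set 'I_n} => #|C|)) : perm_eq (enum (porbits t)) (C0 :: enum B).
    by [].
  by rewrite -{1}(setD1K C0t); apply: perm_enum_setU1; rewrite setD11.
rewrite /cycle_type -/h e.
have /perm_map/perm_trans -> // :
    perm_eq (enum (A |: [set h @: (C : {set 'I_n}) | C in B]))
      (A :: enum [set h @: (C : {set 'I_n}) | C in B]).
  apply: perm_enum_setU1; apply/imsetP => -[C _ eC].
  by have := max_notin C; rewrite -eC setU11.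
rewrite /= cardsU1 max_notin card_imset // add1n perm_cons.
apply: (@perm_trans _ (map (fun C : {set 'I_n} => #|C|) (enum B))).
  by rewrite -card_h; apply: perm_map; apply: perm_enum_imset.
rewrite perm_sym -(perm_cons #|C0|); apply: (perm_trans _ ct).
rewrite perm_sym; apply: perm_to_rem; rewrite (perm_mem ct); exact: mem_head.
Qed.

End Insertion.

Lemma insert_perm_inj n :
  injective (fun jt : 'I_n.+1 * 'S_n => insert_perm jt.2 jt.1).
Proof.
move=> [j t] [k u] /= e.
have jk : j = k.
  apply: (@perm_inj _ (insert_perm u k)).
  by rewrite -{1}e /insert_perm !permM !tpermL !lift_perm_id.
rewrite jk in e *; congr pair.
move/mulgI: e => /permP e; apply/permP => x.
by have := e (lift ord_max x); rewrite !lift_perm_lift => /lift_inj.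
Qed.

Lemma sum_insert_perm n (F : 'S_n.+1 -> R) :
  \sum_(s : 'S_n.+1) F s =
  \sum_(t : 'S_n) (F (insert_perm t ord_max) +
     \sum_(x : 'I_n) F (insert_perm t (lift ord_max x))).
Proof.
rewrite (reindex (fun jt : 'I_n.+1 * 'S_n => insert_perm jt.2 jt.1)) /=; last first.
  apply: onW_bij; apply: inj_card_bij; first exact: insert_perm_inj.
  by rewrite card_prod !card_Sn card_ord factS.
rewrite -(pair_bigA _ (fun j t => F (insert_perm t j))) /= exchange_big /=.
apply: eq_bigr => t _; rewrite big_ord_recr addrC; congr (_ + _).
apply: eq_bigr => x _; congr (F (insert_perm t _)); apply: val_inj.
by apply/esym/lift_max.
Qed.

Definition perm_invariant (g : seq nat -> R) := forall s s', perm_eq s s' -> g s = g s'.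

Lemma crpE th g s : perm_invariant g ->
  crp th g s = th * g (1%N :: s) + \sum_(k <- s) k%:R * g (k.+1 :: rem k s).
Proof.
elim: s g => [|k t IH] g gI /=; first by rewrite big_nil addr0.
rewrite IH; last by move=> s s' e; apply: gI; rewrite perm_cons.
rewrite big_cons /= eqxx RplusE RmultE INRE addrCA; congr (_ + (_ + _)).
  by congr (_ * _); apply: gI; rewrite (perm_catCA [:: k] [:: 1%N] t).
rewrite !big_seq; apply: eq_bigr => x xt; congr (_ * _); apply: gI.
case: eqVneq => [->|_]; last by rewrite (perm_catCA [:: k] [:: x.+1]).
by rewrite (perm_catCA [:: x] [:: x.+1]) perm_cons perm_sym perm_to_rem.
Qed.

Lemma perm_rem (T : eqType) (x : T) s s' : perm_eq s s' -> perm_eq (rem x s) (rem x s').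
Proof.
move=> e; have [xs|xs] := boolP (x \in s); last first.
  by rewrite !rem_id // -(perm_mem e).
rewrite -(perm_cons x) -(permPl (perm_to_rem xs)) (permPl e).
by apply: perm_to_rem; rewrite -(perm_mem e).
Qed.

Lemma crp_perm th g : perm_invariant g -> perm_invariant (crp th g).
Proof.
move=> gI s s' e; rewrite !crpE //; congr (_ * _ + _).
  by apply: gI; rewrite perm_cons.
rewrite (perm_big _ e) /=; apply: eq_bigr => k _; congr (_ * _).
by apply: gI; rewrite perm_cons perm_rem.
Qed.

Lemma size_cycle_type n (s : 'S_n) : size (cycle_type s) = ncycles s.
Proof. by rewrite /cycle_type size_map -cardE. Qed.

Lemma sum_porbit n (s : 'S_n) (G : nat -> R) :
  \sum_(x : 'I_n) G #|porbit s x| = \sum_(k <- cycle_type s) k%:R * G k.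
Proof.
rewrite /cycle_type big_map big_enum /=.
rewrite (partition_big (porbit s) (mem (porbits s))) /=; last by move=> x _; apply: imset_f.
apply: eq_bigr => _ /imsetP [y _ ->].
rewrite (eq_bigr (fun => G #|porbit s y|)); last by move=> x /eqP ->.
rewrite sumr_const mulr_natl; congr (_ *+ _); apply: eq_card => x.
by rewrite -eq_porbit_mem.
Qed.

(* The Ewens measure evolves by the Chinese restaurant process, and so does the law of the
   spacings in the Feller coupling. *)
Lemma ewens_feller th i g : 0 < th -> perm_invariant g ->
  \sum_(s : 'S_i.+1) th ^+ ncycles s * g (cycle_type s) =
  rising th i.+1 * fellerE th i 1 g.
Proof.
move=> th0; elim: i g => [|i IH] g gI.
  rewrite (bigD1 1%g) //= big1 ?addr0 => [|s]; last first.
    by rewrite (_ : s = 1%g) ?eqxx //; apply/permP => x; rewrite !ord1.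
  rewrite /rising big_ord_recl big_ord0 addr0 mulr1.
  have e : perm_eq (cycle_type (1%g : 'S_1)) [:: 1%N].
    rewrite (_ : 1%g = insert_perm (1%g : 'S_0) ord_max); last first.
      by apply/permP => x; rewrite !ord1.
    apply: perm_trans (cycle_type_insert_fix _) _; rewrite perm_cons.
    have : (size (cycle_type (1%g : 'S_0)) <= 0)%N.
      by rewrite size_cycle_type; apply: leq_trans (leq_imset_card _ _) _; rewrite card_ord.
    by case: cycle_type.
  by rewrite -size_cycle_type (perm_size e) /= expr1 (gI _ _ e).
rewrite sum_insert_perm.
transitivity (\sum_(t : 'S_i.+1) th ^+ ncycles t * crp th g (cycle_type t)); last first.
  rewrite IH; last exact: crp_perm.
  rewrite fellerE_crp; last exact/RltP.
  rewrite [rising th i.+2]/rising big_ord_recr /= -/(rising th i.+1) -mulrA; congr (_ * _).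
  rewrite -/(INR i.+1) RdivE INRE mulrC divfK // lt0r_neq0 //.
  by rewrite addr_gt0 // ltr0n.
apply: eq_bigr => t _; rewrite crpE // mulrDr; congr (_ + _).
  have e := cycle_type_insert_fix t.
  by rewrite -size_cycle_type (perm_size e) /= size_cycle_type exprS (gI _ _ e) -mulrA mulrCA.
rewrite -(sum_porbit t (fun k => g (k.+1 :: rem k (cycle_type t)))) mulr_sumr.
apply: eq_bigr => x _; have e := cycle_type_insert t x.
rewrite (gI _ _ e) -!size_cycle_type (perm_size e) /=.
have mem : #|porbit t x| \in cycle_type t.
  by apply/mapP; exists (porbit t x) => //; rewrite mem_enum imset_f.
rewrite size_rem // prednK //.
by case: (cycle_type t) mem.
Qed.

End EwensCrp.

(** * Asymptotics of the mean and of the variance *)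

Section Asymptotics.

Local Open Scope R_scope.

Variable th : R.
Hypothesis th0 : 0 < th.

(** The difference is [fp th j] (1 - th) / (j + 2), of order j^(-2); it is written as a telescoping
    difference for summation. *)
Lemma fp_near j : Rabs (fp th j - th * / INR j.+2) <= (1 + th) ^ 2 * (/ INR j.+1 - / INR j.+2).
Proof.
have d := fp_den th0 j; have [p0 _] := fp_bounds th0 j; have p := fp_le th0 j; rewrite /Rdiv in p.
have x1 := INR_S_gt0 j; have x2 := INR_S_gt0 j.+1.
have e2 : INR j.+2 = INR j.+1 + 1 by apply: S_INR.
have -> : fp th j - th * / INR j.+2 = fp th j * (1 - th) * / INR j.+2.
  by rewrite /fp e2; move: (INR j.+1) x1 d => x x1 d; field; split; lra.
have -> : / INR j.+1 - / INR j.+2 = / INR j.+2 * / INR j.+1.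
  by rewrite e2; move: (INR j.+1) x1 => x x1; field; split; lra.
have y0 : 0 < / INR j.+2 by apply: Rinv_0_lt_compat.
have yz : / INR j.+2 <= / INR j.+1 by apply: Rinv_le_contravar => //; lra.
move: (fp th j) (/ INR j.+2) (/ INR j.+1) p p0 y0 yz => P y z p p0 y0 yz.
rewrite !Rabs_mult (Rabs_pos_eq P) ?(Rabs_pos_eq y); try lra.
have a : Rabs (1 - th) <= 1 + th by apply: Rabs_le; lra.
have a0 := Rabs_pos (1 - th).
have q : P * Rabs (1 - th) <= (1 + th) * y * (1 + th).
  by apply: Rmult_le_compat; lra.
have : P * Rabs (1 - th) * y <= (1 + th) * y * (1 + th) * y by nra.
have : (1 + th) * y * (1 + th) * y <= (1 + th) * y * (1 + th) * z.
  by apply: Rmult_le_compat_l => //; nra.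
by rewrite /=; lra.
Qed.

Section Increments.

Variables (j : nat) (M : R).
Hypotheses (M1 : 1 <= M) (lnM : ln (INR j.+2) <= M).

Let u := ln (INR j.+2).
Let v := ln (INR j.+1).
Let a := / INR j.+1.
Let b := / INR j.+2.

Let ab_facts : 0 < b <= a /\ a * a <= 2 * (a - b) /\ a - b = a * b.
Proof.
have x1 := INR_S_gt0 j; have x2 := INR_S_gt0 j.+1.
have e2 : INR j.+2 = INR j.+1 + 1 by apply: S_INR.
have x3 : 1 <= INR j.+1 by rewrite S_INR; have := pos_INR j; lra.
have e : a - b = a * b.
  by rewrite /a /b e2; move: (INR j.+1) x1 => x x1; field; split; lra.
have a0 : 0 < a by apply: Rinv_0_lt_compat.
have b0 : 0 < b by apply: Rinv_0_lt_compat.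
have a1 : a <= 1 by rewrite -Rinv_1; apply: Rinv_le_contravar; lra.
by split; [split; nra | split => //; nra].
Qed.

Let uv_facts : 0 <= v /\ v <= u <= M /\ b <= u - v <= a.
Proof.
have := ln_succ_ge j; have := ln_succ_le j; have := ln_INR_S_ge0 j.
have := lnM; have [[]] := ab_facts; rewrite -/u -/v -/a -/b.
by move=> *; repeat split; lra.
Qed.

(** With w = u - v in [b, a], the error b u - (u^2 - v^2) / 2 is w^2 / 2 - (w - b) u, and both a^2
    and a - b are O(a - b). *)
Lemma mean_increment :
  Rabs (fp th j * u - th / 2 * (u ^ 2 - v ^ 2)) <=
  ((1 + th) ^ 2 + 2 * th) * M * (a - b).
Proof.
have [[b0 ba] [aa e]] := ab_facts; have [v0 [[vu uM] [bd da]]] := uv_facts.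
have n := fp_near j; rewrite -/a -/b in n.
have -> : fp th j * u - th / 2 * (u ^ 2 - v ^ 2) =
  (fp th j - th * b) * u + th * (b * u - (u ^ 2 - v ^ 2) / 2) by field.
have h1 : Rabs ((fp th j - th * b) * u) <= (1 + th) ^ 2 * (a - b) * M.
  rewrite Rabs_mult (Rabs_pos_eq u); last lra.
  by apply: Rmult_le_compat; try lra; apply: Rabs_pos.
have h2 : Rabs (th * (b * u - (u ^ 2 - v ^ 2) / 2)) <= th * (2 * M * (a - b)).
  rewrite Rabs_mult (Rabs_pos_eq th); last lra.
  apply: Rmult_le_compat_l; first lra.
  set w := u - v in bd da.
  have -> : b * u - (u ^ 2 - v ^ 2) / 2 = w * w / 2 - (w - b) * u by rewrite /w; field.
  have k1 : 0 <= (w - b) * u <= (a - b) * M.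
    by split; [apply: Rmult_le_pos; lra | apply: Rmult_le_compat; lra].
  have k2 : 0 <= w * w <= a * a.
    by split; [apply: Rmult_le_pos; lra | apply: Rmult_le_compat; lra].
  have k3 : a - b <= M * (a - b) by nra.
  by apply: Rabs_le; lra.
by apply: Rle_trans (Rabs_triang _ _) _; lra.
Qed.

(** Same comparison with cubes; the square of [fp th j] in the Bernoulli variance adds a second term
    (1 + th)^2 (a - b). *)
Lemma var_increment :
  Rabs (fp th j * (1 - fp th j) * u ^ 2 - th / 3 * (u ^ 3 - v ^ 3)) <=
  (2 * (1 + th) ^ 2 + 3 * th) * M ^ 2 * (a - b).
Proof.
have [[b0 ba] [aa e]] := ab_facts; have [v0 [[vu uM] [bd da]]] := uv_facts.
have n := fp_near j; rewrite -/a -/b in n.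
have [p0 _] := fp_bounds th0 j; have p := fp_le th0 j; rewrite /Rdiv -/b in p.
have u2 : 0 <= u ^ 2 <= M ^ 2.
  by split; [apply: pow2_ge_0 | apply: pow_incr; lra].
have -> : fp th j * (1 - fp th j) * u ^ 2 - th / 3 * (u ^ 3 - v ^ 3) =
  (fp th j - th * b) * u ^ 2 + (- (fp th j * fp th j * u ^ 2) +
  th * (b * u ^ 2 - (u ^ 3 - v ^ 3) / 3)) by field.
have h1 : Rabs ((fp th j - th * b) * u ^ 2) <= (1 + th) ^ 2 * (a - b) * M ^ 2.
  rewrite Rabs_mult (Rabs_pos_eq (u ^ 2)); last lra.
  by apply: Rmult_le_compat; try lra; apply: Rabs_pos.
have h3 : Rabs (- (fp th j * fp th j * u ^ 2)) <= (1 + th) ^ 2 * (a - b) * M ^ 2.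
  have q : 0 <= fp th j * fp th j <= (1 + th) ^ 2 * (a - b).
    split; first by apply: Rmult_le_pos; lra.
    apply: (Rle_trans _ ((1 + th) * b * ((1 + th) * b))).
      by apply: Rmult_le_compat; lra.
    have -> : (1 + th) * b * ((1 + th) * b) = (1 + th) ^ 2 * (b * b) by ring.
    apply: Rmult_le_compat_l; first exact: pow2_ge_0.
    by rewrite e; nra.
  rewrite Rabs_Ropp Rabs_pos_eq; last by apply: Rmult_le_pos; lra.
  by apply: Rmult_le_compat; lra.
have h2 : Rabs (th * (b * u ^ 2 - (u ^ 3 - v ^ 3) / 3)) <= th * (3 * M ^ 2 * (a - b)).
  rewrite Rabs_mult (Rabs_pos_eq th); last lra.
  apply: Rmult_le_compat_l; first lra.
  have [w ew] : exists w, w = u - v by eexists.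
  rewrite -ew in bd da.
  have -> : b * u ^ 2 - (u ^ 3 - v ^ 3) / 3 =
      w * w * (u - w / 3) - (w - b) * u ^ 2 by rewrite ew; field.
  have k1 : 0 <= (w - b) * u ^ 2 <= (a - b) * M ^ 2.
    by split; [apply: Rmult_le_pos; lra | apply: Rmult_le_compat; lra].
  have k2 : 0 <= w * w <= a * a.
    by split; [apply: Rmult_le_pos; lra | apply: Rmult_le_compat; lra].
  have k4 : 0 <= w * w * (u - w / 3) <= a * a * M.
    by split; [apply: Rmult_le_pos; lra | apply: Rmult_le_compat; lra].
  have k5 : a * a * M <= 2 * (a - b) * M by apply: Rmult_le_compat_r; lra.
  have k3 : (a - b) * M <= (a - b) * M ^ 2.
    by apply: Rmult_le_compat_l; [lra | rewrite /=; nra].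
  by apply: Rabs_le; lra.
apply: Rle_trans (Rabs_triang _ _) _.
have := Rabs_triang (- (fp th j * fp th j * u ^ 2)) (th * (b * u ^ 2 - (u ^ 3 - v ^ 3) / 3)).
lra.
Qed.

End Increments.

Let telescoped i M C : 0 <= C -> 0 <= M -> C * M * (1 - / INR i.+1) <= C * M.
Proof.
move=> C0 M0; rewrite -[X in _ <= X]Rmult_1_r; apply: Rmult_le_compat_l.
  exact: Rmult_le_pos.
by have := Rinv_0_lt_compat _ (INR_S_gt0 i); lra.
Qed.

(** [M] is separate from ln (i + 1) so that it stays fixed in the induction, which proves the
    sharper bound with the telescoped factor 1 - 1 / (i + 1). *)
Lemma renewal_mean_near i M : 1 <= M -> ln (INR i.+1) <= M ->
  Rabs (renewal_mean th i - th / 2 * ln (INR i.+1) ^ 2) <=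
  ((1 + th) ^ 2 + 2 * th) * M.
Proof.
move=> M1 lM; have C0 : 0 <= (1 + th) ^ 2 + 2 * th by have := pow2_ge_0 (1 + th); lra.
apply: Rle_trans (telescoped i C0 (ltac:(lra) : 0 <= M)).
elim: i lM => [|i IH] lM.
  by rewrite /= ln_1 Rinv_1; rewrite Rabs_pos_eq; lra.
have lM' : ln (INR i.+1) <= M.
  apply: Rle_trans lM; apply: ln_le_mono; first exact: INR_S_gt0.
  by rewrite (S_INR i.+1); lra.
have := mean_increment M1 lM; have := IH lM'.
rewrite [renewal_mean th i.+1]/=.
set u := ln (INR i.+2); set v := ln (INR i.+1).
set X := renewal_mean th i; set Y := fp th i * _ => h1 h2.
have -> : X + Y - th / 2 * u ^ 2 =
  (X - th / 2 * v ^ 2) + (Y - th / 2 * (u ^ 2 - v ^ 2)) by ring.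
by apply: Rle_trans (Rabs_triang _ _) _; lra.
Qed.

Lemma renewal_var_near i M : 1 <= M -> ln (INR i.+1) <= M ->
  Rabs (bern_var (fp th) (fun j => ln (INR j.+2)) i - th / 3 * ln (INR i.+1) ^ 3) <=
  (2 * (1 + th) ^ 2 + 3 * th) * M ^ 2.
Proof.
move=> M1 lM; have C0 : 0 <= 2 * (1 + th) ^ 2 + 3 * th by have := pow2_ge_0 (1 + th); lra.
apply: Rle_trans (telescoped i C0 (pow2_ge_0 M)).
elim: i lM => [|i IH] lM.
  by rewrite /= ln_1 Rinv_1; rewrite Rabs_pos_eq; lra.
have lM' : ln (INR i.+1) <= M.
  apply: Rle_trans lM; apply: ln_le_mono; first exact: INR_S_gt0.
  by rewrite (S_INR i.+1); lra.
have := var_increment M1 lM; have := IH lM'.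
rewrite [bern_var _ _ i.+1]/= -/(INR i.+2).
set u := ln (INR i.+2); set v := ln (INR i.+1).
set X := bern_var _ _ _; rewrite -[u * (u * 1)]/(u ^ 2).
set Y := fp th i * _ * _ => h1 h2.
have -> : X + Y - th / 3 * u ^ 3 =
  (X - th / 3 * v ^ 3) + (Y - th / 3 * (u ^ 3 - v ^ 3)) by ring.
by apply: Rle_trans (Rabs_triang _ _) _; lra.
Qed.

Lemma bern_var_scale (p a : nat -> R) sg i : sg <> 0 ->
  bern_var p (fun j => a j / sg) i = bern_var p a i / sg ^ 2.
Proof.
by move=> s0; elim: i => [|i IH] /=; [field | rewrite IH; field].
Qed.

End Asymptotics.

(** * The number of involution factorisations *)

Section Invol.

Lemma invol_ext n (a b : nat -> nat) : (forall k, a k = b k) -> invol n a = invol n b.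
Proof. by move=> ab; apply: eq_bigr => k _; rewrite ab. Qed.

Lemma cycle_countsE n (s : 'S_n) k : cycle_counts s k = count_mem k (cycle_type s).
Proof.
rewrite /cycle_counts -sum1_card /cycle_type count_map -sum1_count big_enum_cond.
by apply: eq_bigl => C; rewrite !inE.
Qed.

Section Factor.

Import GRing.Theory Num.Theory.
Local Open Scope ring_scope.

Definition invol_factor (k c : nat) : R :=
  \sum_(0 <= j < c./2.+1) ((c ^_ (2 * j))%:R / (((2 * k)%:R) ^+ j * (j`!)%:R)).

Lemma invol_factor_ge1 k c : Rle 1 (invol_factor k c).
Proof.
apply/RleP; rewrite /invol_factor big_ltn // muln0 ffactn0 expr0 mul1r divr1 lerDl.
apply: sumr_ge0 => j _.
by rewrite divr_ge0 ?mulr_ge0 ?exprn_ge0 ?ler0n.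
Qed.

Lemma ffact_le_exp c j : (c ^_ j <= c ^ j)%N.
Proof.
elim: j => [//|j IH]; rewrite ffactnSr expnSr.
by apply: leq_mul => //; apply: leq_subr.
Qed.

Lemma exp_partial_sum (y : R) m : Rle 0 y ->
  Rle (\sum_(0 <= j < m.+1) (y ^+ j / (j`!)%:R)) (exp y).
Proof.
move=> y0.
have -> : \sum_(0 <= j < m.+1) (y ^+ j / (j`!)%:R) =
    sum_f_R0 (fun j => Rmult (Rinv (INR (Factorial.fact j))) (pow y j)) m.
  elim: m => [|m IH] /=.
    by rewrite big_nat1 expr0 fact0 divr1 Rinv_1 Rmult_1_r.
  rewrite big_nat_recr //= IH RplusE; congr (_ + _).
  rewrite mulrC -RmultE; congr Rmult; first by rewrite RinvE INRE factE.
  by rewrite -RpowE.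
apply: sum_incr.
  have := proj2_sig (exist_exp y); rewrite /exp_in /infinite_sum => h eps /h [N hN].
  by exists N.
move=> j; apply: Rmult_le_pos; last exact: pow_le.
by apply/Rlt_le/Rinv_0_lt_compat; apply/INR_fact_lt_0.
Qed.

(** Replacing falling factorials by powers turns the sum into a partial exponential series at c^2 /
    (2 k). *)
Lemma invol_factor_le k c : (0 < k)%N ->
  Rle (invol_factor k c) (exp (Rdiv (INR c ^ 2) (Rmult 2 (INR k)))).
Proof.
move=> k0; set y := Rdiv _ _.
have k0' : Rlt 0 (INR k) by apply: lt_0_INR; apply/ltP.
have y0 : Rle 0 y.
  apply: Rmult_le_pos; first exact: pow2_ge_0.
  by apply/Rlt_le/Rinv_0_lt_compat; lra.
apply: Rle_trans (exp_partial_sum c./2 y0); apply/RleP.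
apply: ler_sum => j _.
have -> : y ^+ j = (c ^ (2 * j))%:R / ((2 * k)%:R ^+ j).
  rewrite expnM natrX -expr_div_n; congr (_ ^+ j).
  by rewrite /y RdivE RpowE RmultE !INRE natrX natrM.
rewrite -mulrA -invfM ler_pM2r; first by rewrite ler_nat ffact_le_exp.
by rewrite invr_gt0 mulr_gt0 ?exprn_gt0 ?ltr0n ?fact_gt0 ?muln_gt0.
Qed.

Lemma sum_count_mem n (s : seq nat) (F : nat -> R) :
  all (leq 1) s -> (sumn s <= n)%N ->
  \sum_(1 <= k < n.+1) ((count_mem k s)%:R * F k) = \sum_(k <- s) F k.
Proof.
elim: s => [|x s IH] /=; first by rewrite big_nil big1 // => k _; rewrite mul0r.
case/andP => x1 s1 sn; rewrite big_cons.
under eq_bigr => k _ do rewrite natrD mulrDl.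
rewrite big_split /= IH //; last by apply: leq_trans sn; apply: leq_addl.
congr (_ + _).
rewrite (bigD1_seq x) /= ?iota_uniq //; last first.
  by rewrite mem_index_iota x1 ltnS (leq_trans _ sn) // leq_addr.
rewrite eqxx mul1r big1 ?addr0 // => k /negbTE kx.
by rewrite eq_sym kx mul0r.
Qed.

End Factor.

Local Open Scope R_scope.

Lemma cube_le_pow2 c : INR c ^ 3 <= 4 * 2 ^ c.
Proof.
have base m : (m < 4)%N -> INR m ^ 3 <= 4 * 2 ^ m.
  by case: m => [|[|[|[|//]]]] _ /=; lra.
case: (ltnP c 4) => [|c4]; first exact: base.
have -> : c = (c - 4 + 4)%N by rewrite subnK.
elim: (c - 4)%N => [|m IH]; first by rewrite /=; lra.
rewrite addSn S_INR; set x := INR (m + 4) in IH *.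
have x4 : 4 <= x by rewrite /x plus_INR /=; have := pos_INR m; lra.
have : (x + 1) ^ 3 <= 2 * x ^ 3 by rewrite /=; nra.
by rewrite -[2 ^ (m + 4).+1]/(2 * 2 ^ (m + 4)); lra.
Qed.

(** The supersolutions handle multiplicative functionals, hence 2^c in place of a power of c. The
    moment bound for 2^c does not decay in k, so c^2 / (2 k) is split: c / 2 adds up to half the
    number of cycles, and the rest has the summable weight 1 / k^2. *)
Lemma invol_factor_ln k c : (0 < k)%N ->
  0 <= ln (invol_factor k c) <= INR c / 2 + 2 * (2 ^ c / INR k ^ 2).
Proof.
move=> k0; have f1 := invol_factor_ge1 k c.
have kk : 0 < INR k by apply: lt_0_INR; apply/ltP.
split; first by rewrite -ln_1; apply: ln_le_mono; lra.
apply: (Rle_trans _ (INR c ^ 2 / (2 * INR k))).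
  rewrite -[X in _ <= X]ln_exp; apply: ln_le_mono; first lra.
  exact: invol_factor_le.
have c0 := pos_INR c; have c3 := cube_le_pow2 c.
apply: (Rmult_le_reg_r (2 * INR k ^ 2)); first by rewrite /=; nra.
have -> : INR c ^ 2 / (2 * INR k) * (2 * INR k ^ 2) = INR c ^ 2 * INR k by field; lra.
have -> : (INR c / 2 + 2 * (2 ^ c / INR k ^ 2)) * (2 * INR k ^ 2) =
  INR c * INR k ^ 2 + 4 * 2 ^ c by field; lra.
(* Expanding c (k - c)^2 >= 0 bounds c^2 k by the mean of c k^2 and c^3. *)
have : 0 <= INR c * (INR k - INR c) ^ 2 by apply: Rmult_le_pos => //; apply: pow2_ge_0.
have : 0 <= INR c ^ 2 * INR k by apply: Rmult_le_pos; [apply: pow2_ge_0 | lra].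
have e : INR c * (INR k - INR c) ^ 2 = INR c * INR k ^ 2 - 2 * (INR c ^ 2 * INR k) + INR c ^ 3 by ring.
lra.
Qed.

Fixpoint pow2_counts (s : seq nat) (n : nat) : R :=
  if n is m.+1 then pow2_counts s m + 2 ^ count_mem m.+1 s / INR m.+1 ^ 2 else 0.

Lemma ln_invol_counts s :
  all (leq 1) s ->
  log_prod s <= ln (invol (sumn s) (fun k => count_mem k s)) <=
  log_prod s + INR (size s) / 2 + 2 * pow2_counts s (sumn s).
Proof.
move=> s1.
have -> : log_prod s = (\sum_(1 <= k < (sumn s).+1) ((count_mem k s)%:R * ln (INR k)))%R.
  by rewrite sum_count_mem //; elim: (s) => [|k t IH] /=; rewrite ?big_nil // big_cons IH.
have -> : INR (size s) = (\sum_(1 <= k < (sumn s).+1) ((count_mem k s)%:R * 1))%R.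
  rewrite sum_count_mem //; elim: (s) => [|k t IH] /=; rewrite ?big_nil // big_cons -IH.
  by rewrite -/(INR (size t).+1) S_INR Rplus_comm.
suff h m : 0 < invol m (fun k => count_mem k s) /\
   (\sum_(1 <= k < m.+1) ((count_mem k s)%:R * ln (INR k)))%R <=
   ln (invol m (fun k => count_mem k s)) <=
   (\sum_(1 <= k < m.+1) ((count_mem k s)%:R * ln (INR k)))%R +
   (\sum_(1 <= k < m.+1) ((count_mem k s)%:R * 1))%R / 2 + 2 * pow2_counts s m.
  by have [_] := h (sumn s).
elim: m => [|m [IH0 IH]].
  rewrite /invol !big_geq //; split; first exact: Rlt_0_1.
  by change (0 <= ln 1 <= 0 + 0 / 2 + 2 * 0); rewrite ln_1; split; lra.
have rs (F : nat -> R) : (\sum_(1 <= k < m.+2) F k)%R = (\sum_(1 <= k < m.+1) F k)%R + F m.+1.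
  by rewrite big_nat_recr.
have ri (a : nat -> nat) :
    invol m.+1 a = invol m a * (INR m.+1 ^ a m.+1 * invol_factor m.+1 (a m.+1)).
  by rewrite /invol big_nat_recr // RpowE INRE.
rewrite ri !rs.
rewrite [pow2_counts s m.+1](_ : _ = pow2_counts s m + 2 ^ count_mem m.+1 s / INR m.+1 ^ 2) //.
move: (\sum_(1 <= k < m.+1) _)%R (\sum_(1 <= k < m.+1) _)%R IH => S1 S2 IH.
rewrite -!RmultE -!INRE -R1E Rmult_1_r.
set I := invol m _ in IH0 IH *; set c := count_mem _ s.
have [f0 f1] := @invol_factor_ln m.+1 c isT.
have f2 := invol_factor_ge1 m.+1 c.
have p : 0 < INR m.+1 ^ c by apply: pow_lt; apply: INR_S_gt0.
rewrite !ln_mult //; try lra; last by apply: Rmult_lt_0_compat; lra.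
rewrite ln_pow; last exact: INR_S_gt0.
split; first by apply: Rmult_lt_0_compat => //; apply: Rmult_lt_0_compat; lra.
by split; lra.
Qed.

End Invol.

(** * The central limit theorem *)

Section EwensLaw.

Local Open Scope R_scope.

Variable th : R.
Hypothesis th0 : 0 < th.

Definition norm_log_invol_list (n : nat) (s : seq nat) : R :=
  (ln (invol n (fun k => count_mem k s)) - th / 2 * (ln (INR n)) ^ 2)
     / sqrt (th / 3 * (ln (INR n)) ^ 3).

Lemma esf_prob_feller i x :
  esf_prob th i.+1 (fun s : 'S_i.+1 => (norm_log_invol th s <= x)%O) =
  fellerE th i 1 (fun s => indle (norm_log_invol_list i.+1 s) x).
Proof.
pose g s := indle (norm_log_invol_list i.+1 s) x.
have gI : perm_invariant g.
  move=> s s' /seq.permP e; rewrite /g /norm_log_invol_list.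
  by rewrite (@invol_ext _ _ (fun k => count_mem k s')).
have r0 : rising th i.+1 <> 0.
  apply/eqP; apply/GRing.Theory.prodf_neq0 => j _; apply/eqP.
  have p : 0 < th + INR j by have := pos_INR j; lra.
  by rewrite -INRE; apply: Rgt_not_eq p.
have e := ewens_feller i (introT RltP th0) gI.
apply: (Rmult_eq_reg_l (rising th i.+1)) => //.
rewrite -/g [RHS]RmultE -e /esf_prob RmultE GRing.mulr_sumr big_mkcond /=.
apply: eq_bigr => s _; have -> : g (cycle_type s) = indle (norm_log_invol th s) x.
  rewrite /g /norm_log_invol_list /norm_log_invol.
  by rewrite (@invol_ext _ _ (cycle_counts s)) // => k; rewrite cycle_countsE.
rewrite /indle; case: Rle_dec => [/RleP -> | /RleP /negbTE ->] /=.
  by rewrite GRing.mulr1 GRing.mulrC GRing.divfK //; apply/eqP.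
by rewrite GRing.mulr0.
Qed.

Lemma weight_two s : weight (fun _ _ => 2) s = exp (INR (size s) * ln 2).
Proof.
elim: s => [|k s IH]; first by rewrite /= Rmult_0_l exp_0.
rewrite [weight _ _]/= IH -[size (k :: s)]/((size s).+1) S_INR Rmult_plus_distr_r exp_plus Rmult_1_l exp_ln; lra.
Qed.

Lemma sqrt_exp x : 0 < x -> sqrt x = exp (ln x / 2).
Proof.
move=> x0; have s := sqrt_lt_R0 x x0.
rewrite -{2}(sqrt_sqrt x); last lra.
rewrite ln_mult // -[LHS]exp_ln //; congr exp; field.
Qed.

Lemma weight_spacing s : all (leq 1) s ->
  weight (spacing_weight th) s =
  exp (log_ratio s / 2 - INR (size s) * ln (3 + 2 * th)).
Proof.
elim: s => [|k s IH].
  by move=> _; rewrite /= Rmult_0_l Rminus_0_r /Rdiv Rmult_0_l exp_0.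
case/andP => k0 /IH {}IH; rewrite [weight _ _]/= IH -[size (k :: s)]/((size s).+1) S_INR.
have x0 : 0 < INR k by apply: lt_0_INR; apply/ltP.
rewrite /spacing_weight !sqrt_exp //; last exact: INR_S_gt0.
have q0 : 0 < 3 + 2 * th by lra.
rewrite -{1}(exp_ln _ q0) /Rdiv -!exp_Ropp -!exp_plus.
rewrite [log_ratio (k :: s)](_ : _ = ln (INR (k + sumn s).+1) - ln (INR k) + log_ratio s) //.
by congr exp; field.
Qed.

Lemma fellerE_pow2_counts i n :
  fellerE th i 1 (fun s => pow2_counts s n) <= 4 * exp (4 * (1 + th) ^ 2).
Proof.
set E := exp _; have E0 : 0 < E by apply: exp_pos.
have x0 := INR_S_gt0 n; have := Rinv_0_lt_compat _ x0 => x1.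
apply: (Rle_trans _ (4 * E * (1 - / INR n.+1))); last by nra.
elim: n {x0 x1} => [|n IH].
  by rewrite /= fellerE_cst Rinv_1; lra.
have y0 := INR_S_gt0 n; have y1 := INR_S_gt0 n.+1.
rewrite (@fellerE_ext _ th0 _ _ _ (fun s => / INR n.+1 ^ 2 * 2 ^ count_mem n.+1 s + pow2_counts s n)) //; last first.
  move=> s _ _ _; change (pow2_counts s n + 2 ^ count_mem n.+1 s / INR n.+1 ^ 2 =
    / INR n.+1 ^ 2 * 2 ^ count_mem n.+1 s + pow2_counts s n).
  by rewrite /Rdiv; ring.
rewrite fellerE_lin.
have h := fellerE_pow2_count th0 i (isT : (0 < n.+1)%N); rewrite -/E in h.
have z0 : 0 < / INR n.+1 ^ 2 by apply: Rinv_0_lt_compat; apply: pow_lt.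
have := Rmult_le_compat_l _ _ _ (Rlt_le _ _ z0) h.
have e2 : INR n.+2 = INR n.+1 + 1 by apply: S_INR.
have x1 : 1 <= INR n.+1 by rewrite S_INR; have := pos_INR n; lra.
have z : / INR n.+1 ^ 2 <= 2 * (/ INR n.+1 - / INR n.+2).
  have -> : 2 * (/ INR n.+1 - / INR n.+2) = 2 * / (INR n.+1 * INR n.+2).
    by rewrite e2; move: (INR n.+1) y0 => y y0; field; split; lra.
  have -> : 2 * / (INR n.+1 * INR n.+2) = / (INR n.+1 * INR n.+2 / 2).
    by rewrite e2; move: (INR n.+1) y0 => y y0; field; split; lra.
  by rewrite e2; move: (INR n.+1) x1 => y y1'; apply: Rinv_le_contravar; rewrite /=; nra.
by move: IH; nra.
Qed.

(** * Tails of the two error terms *)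

Section Tails.

Variable L : R.
Hypothesis L1 : 1 <= L.

(* [B] is chosen so that [2 ^ (B * L) = exp ((2 + th) * L)]. *)
Let B := (2 + th) / ln 2.
(** If there are at most B L spacings, a log ratio above [ratio_cst * L] makes the exponent in
    [weight_spacing] at least L. In [corr_cst], B / 2 pays for half the size and 1 is the threshold
    left for the counts. *)
Definition ratio_cst : R := 2 * (1 + B * ln (3 + 2 * th)).
Definition corr_cst : R := B / 2 + 1.

Let ln2_gt0 : 0 < ln 2.
Proof. by rewrite -ln_1; apply: ln_increasing; lra. Qed.

Let B_ge0 : 0 <= B.
Proof. by apply: Rmult_le_pos; [lra | apply/Rlt_le/Rinv_0_lt_compat]. Qed.

Let lnq_ge0 : 0 <= ln (3 + 2 * th).
Proof. by rewrite -ln_1; apply: ln_le_mono; lra. Qed.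

Lemma ratio_cst_ge0 : 0 <= ratio_cst.
Proof. by rewrite /ratio_cst; have := Rmult_le_pos _ _ B_ge0 lnq_ge0; lra. Qed.

Lemma corr_cst_ge0 : 0 <= corr_cst.
Proof. by rewrite /corr_cst; lra. Qed.

Let size_tail (s : seq nat) : B * L < INR (size s) ->
  1 <= exp (- ((2 + th) * L)) * weight (fun _ _ => 2) s.
Proof.
move=> h; rewrite weight_two -exp_plus -exp_0; apply: exp_le_mono.
have e : B * ln 2 = 2 + th by rewrite /B; field; lra.
have := Rmult_le_compat_r _ _ _ (Rlt_le _ _ ln2_gt0) (Rlt_le _ _ h).
have -> : B * L * ln 2 = (B * ln 2) * L by ring.
rewrite e; lra.
Qed.

Let exp_small : exp (- L) <= / L.
Proof.
rewrite exp_Ropp; apply: Rinv_le_contravar; first lra.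
by have := exp_ineq1_le L; lra.
Qed.

Let weight_two_ge0 s : 0 <= exp (- ((2 + th) * L)) * weight (fun _ _ => 2) s.
Proof.
apply: Rmult_le_pos; first exact/Rlt_le/exp_pos.
by apply: weight_ge0 => _ _; lra.
Qed.

Variable i : nat.
Hypothesis Li : L = ln (INR i.+1).

(** The exponent 2 + th exceeds the growth exponent 1 + th by one, leaving 2 exp (- L). *)
Let size_tailE :
  exp (- ((2 + th) * L)) * fellerE th i 1 (weight (fun _ _ => 2)) <= 2 * / L.
Proof.
apply: (Rle_trans _ (2 * exp (- L))); last by have := exp_small; lra.
have -> : exp (- L) = exp (- ((2 + th) * L)) * exp ((1 + th) * L).
  by rewrite -exp_plus; congr exp; ring.
have := fellerE_pow2_size th0 i; rewrite -Li.
have := exp_pos (- ((2 + th) * L)); nra.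
Qed.

(** Chernoff bound: outside the good event, either the size exceeds B L or the spacing weight is at
    least exp L. *)
Lemma ratio_tail :
  fellerE th i 1 (fun s => 1 - indle (log_ratio s) (ratio_cst * L)) <=
  (5 + 2 * th) / L.
Proof.
pose W := weight (fun _ _ => 2).
apply: (Rle_trans _ (fellerE th i 1 (fun s => exp (- ((2 + th) * L)) * W s +
    (exp (- L) * weight (spacing_weight th) s + 0)))).
  apply: fellerE_le => // s _ s1 _.
  have w0 := weight_two_ge0 s; rewrite -/W in w0.
  rewrite weight_spacing // -exp_plus.
  have := exp_pos (- L + (log_ratio s / 2 - INR (size s) * ln (3 + 2 * th))) => e0.
  have [h|h] := Rle_lt_dec (log_ratio s) (ratio_cst * L).
    by rewrite indle_true //; lra.
  rewrite indle_false //.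
  have [k|k] := Rle_lt_dec (INR (size s)) (B * L); last first.
    by have := size_tail k; rewrite -/W; lra.
  suff : 1 <= exp (- L + (log_ratio s / 2 - INR (size s) * ln (3 + 2 * th))) by lra.
  rewrite -[X in X <= _]exp_0; apply: exp_le_mono.
  have := Rmult_le_compat_r _ _ _ lnq_ge0 k.
  by move: h; rewrite /ratio_cst; lra.
rewrite !fellerE_lin fellerE_cst.
have := size_tailE; rewrite -/W => h1.
have h2 := fellerE_spacing_weight th0 i.
have := Rmult_le_compat_l _ _ _ (Rlt_le _ _ (exp_pos (- L))) h2.
have h3 : exp (- L) * (3 + 2 * th) <= / L * (3 + 2 * th).
  by apply: Rmult_le_compat_r; [lra | exact: exp_small].
rewrite /Rdiv; lra.
Qed.

(** With the size at most B L, a first-moment Markov bound suffices, since the mean of [pow2_counts]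
    is bounded. *)
Lemma corr_tail n :
  fellerE th i 1 (fun s =>
    1 - indle (INR (size s) / 2 + 2 * pow2_counts s n) (corr_cst * L)) <=
  (2 + 8 * exp (4 * (1 + th) ^ 2)) / L.
Proof.
pose W := weight (fun _ _ => 2).
have Q0 s : 0 <= pow2_counts s n.
  elim: n => [|m IH] /=; first lra.
  apply: Rplus_le_le_0_compat => //; apply: Rmult_le_pos; first by apply: pow_le; lra.
  by apply/Rlt_le/Rinv_0_lt_compat; apply: (pow_lt (INR m.+1) 2); apply: INR_S_gt0.
have Li0 : 0 < / L by apply: Rinv_0_lt_compat; lra.
apply: (Rle_trans _ (fellerE th i 1 (fun s => exp (- ((2 + th) * L)) * W s +
    (2 * / L * pow2_counts s n + 0)))).
  apply: fellerE_le => // s _ s1 _.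
  have w0 := weight_two_ge0 s; rewrite -/W in w0.
  have q0 := Q0 s; set Q := pow2_counts s n in q0 *.
  have z : 0 <= 2 * / L * Q by nra.
  have [h|h] := Rle_lt_dec (INR (size s) / 2 + 2 * Q) (corr_cst * L).
    by rewrite indle_true //; lra.
  rewrite indle_false //.
  have [k|k] := Rle_lt_dec (INR (size s)) (B * L); last first.
    by have := size_tail k; rewrite -/W; lra.
  suff : 1 <= 2 * / L * Q by lra.
  apply: (Rmult_le_reg_r L); first lra.
  have -> : 2 * / L * Q * L = 2 * Q by field; lra.
  by move: h; rewrite /corr_cst; lra.
rewrite !fellerE_lin fellerE_cst.
have := size_tailE; rewrite -/W => h1.
have h2 := fellerE_pow2_counts i n.
have := Rmult_le_compat_l (2 * / L) _ _ ltac:(lra) h2.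
rewrite /Rdiv; lra.
Qed.

End Tails.

Lemma renewal_berry_esseen i x (L := ln (INR i.+1)) (sg := sqrt (th / 3 * L ^ 3)) :
  1 <= L -> L / sg <= 1 ->
  (2 * (1 + th) ^ 2 + 3 * th) * (3 / th) / L <= / 2 ->
  Rabs (fellerE th i 1 (fun s => indle ((renewal_sum s - renewal_mean th i) / sg) x) - Phi x)
  <= 8 * (L / sg) + 2 * ((2 * (1 + th) ^ 2 + 3 * th) * (3 / th) / L).
Proof.
move=> L1 d1 eta1.
have L3 : 0 < th / 3 * L ^ 3 by apply: Rmult_lt_0_compat; [lra | apply: pow_lt; lra].
have sg0 : 0 < sg by apply: sqrt_lt_R0.
have sg2 : sg ^ 2 = th / 3 * L ^ 3 by rewrite /= Rmult_1_r sqrt_sqrt //; lra.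
rewrite (fellerE_renewal_sum th0 i (fun z => indle ((z - renewal_mean th i) / sg) x) (sg := sg)) //; last lra.
rewrite (@bernE_ext _ _ (fp01 th0) _ _ (fun y => indle y x)); last first.
  by move=> y; congr (indle _ x); field; lra.
apply: berry_esseen => //.
- by move=> j; apply: fp01.
- move=> j ji; split.
    apply: Rmult_le_pos; first exact: ln_INR_S_ge0.
    exact/Rlt_le/Rinv_0_lt_compat.
  apply: Rmult_le_compat_r; first exact/Rlt_le/Rinv_0_lt_compat.
  apply: ln_le_mono; first exact: INR_S_gt0.
  by apply: le_INR; apply/leP.
- split => //; apply: Rmult_le_pos; first lra.
  exact/Rlt_le/Rinv_0_lt_compat.
rewrite bern_var_scale; last lra.
have := renewal_var_near th0 L1 (Rle_refl L); rewrite -/L.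
set V := bern_var _ _ _ => h.
have s2 : 0 < sg ^ 2 by rewrite sg2.
have -> : V / sg ^ 2 - 1 = (V - th / 3 * L ^ 3) * / sg ^ 2.
  by rewrite -sg2; field; lra.
rewrite Rabs_mult (Rabs_pos_eq (/ sg ^ 2)); last exact/Rlt_le/Rinv_0_lt_compat.
have -> : (2 * (1 + th) ^ 2 + 3 * th) * (3 / th) / L =
  (2 * (1 + th) ^ 2 + 3 * th) * L ^ 2 * / sg ^ 2.
  by rewrite sg2; field; split; lra.
by apply: Rmult_le_compat_r => //; apply/Rlt_le/Rinv_0_lt_compat.
Qed.

Lemma ewens_berry_esseen i x (L := ln (INR i.+1)) (sg := sqrt (th / 3 * L ^ 3))
    (eta := (2 * (1 + th) ^ 2 + 3 * th) * (3 / th) / L) :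
  1 <= L -> L / sg <= 1 -> eta <= / 2 ->
  Rabs (fellerE th i 1 (fun s => indle (norm_log_invol_list i.+1 s) x) - Phi x) <=
  (8 + (ratio_cst + corr_cst + ((1 + th) ^ 2 + 2 * th) + 2)) * (L / sg) + 2 * eta +
  (5 + 2 * th + (2 + 8 * exp (4 * (1 + th) ^ 2))) / L.
Proof.
move=> L1 d1 eta1.
have L3 : 0 < th / 3 * L ^ 3 by apply: Rmult_lt_0_compat; [lra | apply: pow_lt; lra].
have sg0 : 0 < sg by apply: sqrt_lt_R0.
have rc := ratio_cst_ge0; have cc := corr_cst_ge0.
have mc : 0 <= (1 + th) ^ 2 + 2 * th by have := pow2_ge_0 (1 + th); lra.
(* Shift budget in units of L: log ratio, correction, centring, and 2 for ln (n + 1) <= L + 1 <= 2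
   L. *)
set c0 := ratio_cst + corr_cst + ((1 + th) ^ 2 + 2 * th) + 2.
pose e := c0 * (L / sg).
have d0 : 0 <= L / sg by apply: Rmult_le_pos; [lra | exact/Rlt_le/Rinv_0_lt_compat].
have e0 : 0 <= e by apply: Rmult_le_pos; rewrite /c0; lra.
have esg : e * sg = c0 * L by rewrite /e; field; lra.
have /Rabs_le_between hm := renewal_mean_near th0 L1 (Rle_refl L).
rewrite -/L in hm.
have Y s t : (renewal_sum s - renewal_mean th i) / sg <= t <->
    renewal_sum s <= t * sg + renewal_mean th i.
  split => h.
    have := Rmult_le_compat_r _ _ _ (Rlt_le _ _ sg0) h.
    by rewrite /Rdiv Rmult_assoc Rinv_l; lra.
  apply: (Rmult_le_reg_r sg) => //.
  by rewrite /Rdiv Rmult_assoc Rinv_l; lra.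
have Z s : norm_log_invol_list i.+1 s <= x <->
    ln (invol i.+1 (fun k => count_mem k s)) <= x * sg + th / 2 * L ^ 2.
  rewrite /norm_log_invol_list -/L -/sg; split => h.
    have := Rmult_le_compat_r _ _ _ (Rlt_le _ _ sg0) h.
    by rewrite /Rdiv Rmult_assoc Rinv_l; lra.
  apply: (Rmult_le_reg_r sg) => //.
  by rewrite /Rdiv Rmult_assoc Rinv_l; lra.
have lnS : 0 <= ln (INR i.+2) <= L + 1.
  split; first exact: ln_INR_S_ge0.
  have := ln_succ_le i; have : / INR i.+1 <= 1.
    rewrite -Rinv_1; apply: Rinv_le_contravar; first lra.
    by rewrite S_INR; have := pos_INR i; lra.
  by rewrite -/L; lra.
pose P t := fellerE th i 1 (fun s => indle ((renewal_sum s - renewal_mean th i) / sg) t).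
set G := fellerE th i 1 _.
(* The correction is nonnegative, so this direction only needs the log ratio to be small. *)
have up : G <= P (x + e) + (5 + 2 * th) / L.
  apply: (Rle_trans _ (fellerE th i 1 (fun s =>
      1 * indle ((renewal_sum s - renewal_mean th i) / sg) (x + e) +
      (1 - indle (log_ratio s) (ratio_cst * L))))); last first.
    by rewrite fellerE_lin -/(P _); have := ratio_tail L1 (erefl L); lra.
  apply: fellerE_le => // s sn s1 _.
  have [b1 b2] := indle_bounds ((renewal_sum s - renewal_mean th i) / sg) (x + e).
  have [r1 r2] := indle_bounds (log_ratio s) (ratio_cst * L).
  have [g1 g2] := indle_bounds (norm_log_invol_list i.+1 s) x.
  have [k|k] := Rle_lt_dec (log_ratio s) (ratio_cst * L); last first.
    by rewrite (indle_false k); lra.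
  rewrite (indle_true k) Rmult_1_l Rminus_diag Rplus_0_r.
  apply: indle_mono => /Z h; apply/Y.
  have [lo _] := ln_invol_counts s1; rewrite sn addn1 in lo.
  have lp := log_prodE s; rewrite sn addn1 in lp.
  by rewrite Rmult_plus_distr_r esg /c0; nra.
(* The log ratio is nonnegative, so this direction only needs the correction to be small. *)
have lo : P (x - e) <= G + (2 + 8 * exp (4 * (1 + th) ^ 2)) / L.
  apply: (Rle_trans _ (fellerE th i 1 (fun s =>
      1 * indle (norm_log_invol_list i.+1 s) x +
      (1 - indle (INR (size s) / 2 + 2 * pow2_counts s i.+1) (corr_cst * L))))); last first.
    by rewrite fellerE_lin -/G; have := corr_tail L1 (erefl L) i.+1; lra.
  apply: fellerE_le => // s sn s1 _.
  have [b1 b2] := indle_bounds ((renewal_sum s - renewal_mean th i) / sg) (x - e).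
  have [g1 g2] := indle_bounds (norm_log_invol_list i.+1 s) x.
  have [k|k] := Rle_lt_dec (INR (size s) / 2 + 2 * pow2_counts s i.+1) (corr_cst * L); last first.
    by rewrite (indle_false k); lra.
  rewrite (indle_true k) Rmult_1_l Rminus_diag Rplus_0_r.
  apply: indle_mono => /Y h; apply/Z.
  have [_ hi] := ln_invol_counts s1; rewrite sn addn1 in hi.
  have lp := log_prodE s; rewrite sn addn1 in lp.
  have lr : 0 <= log_ratio s.
    elim: (s) s1 {sn b1 b2 g1 g2 k h hi lp} => [|k t IH] /=; first lra.
    case/andP => k0 /IH {}IH; apply: Rplus_le_le_0_compat => //.
    have : ln (INR k) <= ln (INR (k + sumn t).+1).
      apply: ln_le_mono; first by apply: lt_0_INR; apply/ltP.
      by apply: le_INR; apply/leP; rewrite leqW // leq_addr.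
    by rewrite -/(INR (k + sumn t).+1); lra.
  rewrite Rmult_minus_distr_r esg /c0 in h.
  by nra.
have /Rabs_le_between bu := renewal_berry_esseen (x + e) L1 d1 eta1.
have /Rabs_le_between bl := renewal_berry_esseen (x - e) L1 d1 eta1.
rewrite -/L -/sg -/eta -/(P (x + e)) in bu; rewrite -/L -/sg -/eta -/(P (x - e)) in bl.
have := @Phi_lipschitz x (x + e) ltac:(lra); have := @Phi_lipschitz (x - e) x ltac:(lra).
have t1 : 0 <= (5 + 2 * th) / L by apply: Rmult_le_pos; [lra | apply/Rlt_le/Rinv_0_lt_compat; lra].
have t2 : 0 <= (2 + 8 * exp (4 * (1 + th) ^ 2)) / L.
  apply: Rmult_le_pos; last by apply/Rlt_le/Rinv_0_lt_compat; lra.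
  by have := exp_pos (4 * (1 + th) ^ 2); lra.
have -> : (5 + 2 * th + (2 + 8 * exp (4 * (1 + th) ^ 2))) / L =
  (5 + 2 * th) / L + (2 + 8 * exp (4 * (1 + th) ^ 2)) / L by rewrite /Rdiv; ring.
rewrite Rmult_plus_distr_r -/e.
by move=> p1 p2; apply: Rabs_le; lra.
Qed.

Lemma esf_prob_rate : exists (C : R) (N : nat), forall n, (N <= n)%N -> forall x,
  Rabs (esf_prob th n (fun s : 'S_n => (norm_log_invol th s <= x)%O) - Phi x) <=
  C / sqrt (ln (INR n)).
Proof.
set c1 := 8 + (ratio_cst + corr_cst + ((1 + th) ^ 2 + 2 * th) + 2).
set c2 := (2 * (1 + th) ^ 2 + 3 * th) * (3 / th).
set c3 := 5 + 2 * th + (2 + 8 * exp (4 * (1 + th) ^ 2)).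
have k0 : 0 < 3 / th by apply: Rdiv_lt_0_compat; lra.
have p2 := pow2_ge_0 (1 + th).
have c20 : 0 <= c2 by apply: Rmult_le_pos; lra.
have c30 : 0 <= c3 by rewrite /c3; have := exp_pos (4 * (1 + th) ^ 2); lra.
(* The three terms secure L >= 1, L / sg <= 1 (that is, L >= 3 / th) and eta = c2 / L <= 1/2. *)
pose L0 := 1 + 3 / th + 2 * c2.
have [N0 hN] := INR_unbounded (exp L0).
exists (c1 * sqrt (3 / th) + 2 * c2 + c3), N0 => n Nn x.
have nL : exp L0 <= INR n.
  by apply: (Rle_trans _ (INR N0)); [lra | apply: le_INR; apply/leP].
case: n Nn nL => [|i] _ nL; first by have := exp_pos L0; rewrite /= in nL; lra.
rewrite esf_prob_feller //.
have hL : L0 <= ln (INR i.+1).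
  by rewrite -[L0]ln_exp; apply: ln_le_mono => //; apply: exp_pos.
have := @ewens_berry_esseen i x; cbv zeta.
set L := ln (INR i.+1) in hL *; rewrite -/c1 -/c2 -/c3.
have L1 : 1 <= L by rewrite /L0 in hL; lra.
have sL : 0 < sqrt L by apply: sqrt_lt_R0; lra.
have d : L / sqrt (th / 3 * L ^ 3) = sqrt (3 / th) / sqrt L.
  have L3 : 0 < th / 3 * L ^ 3 by apply: Rmult_lt_0_compat; [lra | apply: pow_lt; lra].
  rewrite -sqrt_div_alt; last lra.
  rewrite -{1}(sqrt_pow2 L); last lra.
  rewrite -sqrt_div_alt //; congr sqrt; field; lra.
have ss : sqrt L * sqrt L = L by apply: sqrt_sqrt; lra.
have s1 : 1 <= sqrt L by rewrite -sqrt_1; apply: sqrt_le_1_alt.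
rewrite d => main; apply: Rle_trans (main _ _ _) _ => //.
- apply: (Rmult_le_reg_r (sqrt L)) => //.
  rewrite /Rdiv Rmult_assoc Rinv_l ?Rmult_1_l ?Rmult_1_r; last lra.
  by apply: sqrt_le_1_alt; rewrite /L0 in hL; lra.
- apply: (Rmult_le_reg_r L); first lra.
  by rewrite /Rdiv Rmult_assoc Rinv_l ?Rmult_1_r; rewrite /L0 in hL; lra.
have inv : / L <= / sqrt L by apply: Rinv_le_contravar => //; nra.
have := Rmult_le_compat_l _ _ _ c20 inv; have := Rmult_le_compat_l _ _ _ c30 inv.
by rewrite /Rdiv; lra.
Qed.

End EwensLaw.

Unset Implicit Arguments.

Theorem theorem5p7 (theta : R) (htheta : Rlt 0 theta) :
  exists (C : R) (N : nat), forall (n : nat), (N <= n)%N -> forall x : R,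
    Rle
      (Rabs (Rminus
         (esf_prob theta n (fun s : 'S_n => (norm_log_invol theta s <= x)%O))
         (Phi x)))
      (Rdiv C (sqrt (ln (INR n)))).
Proof. exact: esf_prob_rate. Qed.
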